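(* Let $G$ be a graph. A set $X\subseteq V(G)$ is a maximal barrier of $G$ if and only if there exists a spanning legitimate normalized upper ideal $\mathcal{I}$ of the TFR poset $(\mathcal{D}(G),\preceq,\smile)$ such that $X=\bigcup\{\pi(C): C\in\mathcal{I}\}$.
   Context: Graphs are finite and undirected. For $X\subseteq V(G)$, $G[X]$ is the induced subgraph and $N_G(X)$ is the set of vertices in $V(G)\setminus X$ adjacent to some vertex of $X$. Let $\nu(G)$ be the maximum size of a matching and $\mathrm{def}(G)=|V(G)|-2\nu(G)$. A graph is factor-critical if deleting any one vertex leaves a graph with a perfect matching (a one-vertex graph is factor-critical). $D(G)$ is the set of vertices exposed (not covered) by some maximum matching, and $A(G)=N_G(D(G))$. Barriers. $q_G(X)$ is the number of connected components of $G-X$ with an odd number of vertices. $X\subseteq V(G)$ is a barrier if $\mathrm{def}(G)=q_G(X)-|X|$. A barrier is maximal if it is inclusion-wise maximal among barriers. Factor-components. An edge is allowed if it lies in some maximum matching. Two vertices are factor-connected if they are joined by a path all of whose edges are allowed; the factor-components of $G$ are the subgraphs induced by the equivalence classes of this relation, and $\mathcal{G}(G)$ is the set of factor-components. A factor-component $H$ is inconsistent if $V(H)\cap D(G)\ne\emptyset$, and consistent otherwise. Order. A set $X\subseteq V(G)$ is separating if it is a disjoint union of vertex sets of factor-components. For $G_1,G_2\in\mathcal{G}(G)$, write $G_1\triangleleft G_2$ if there is a separating set $X\supseteq V(G_1)\cup V(G_2)$ such that the contraction $G[X]/V(G_1)$ is factor-critical. It is known that $\triangleleft$ is a partial order on $\mathcal{G}(G)$.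 General Kotzig–Lovász decomposition. For $u,v\in V(G)\setminus D(G)$, let $u\sim_G v$ if $u=v$, or if $u,v$ are factor-connected and $\mathrm{def}(G-u-v)>\mathrm{def}(G)$. It is known that $\sim_G$ is an equivalence relation; $\mathcal{P}(G)$ is the family of its classes, and for $H\in\mathcal{G}(G)$, $\mathcal{P}_G(H)$ is the family of classes contained in $V(H)$ (a partition of $V(H)\setminus D(G)$). It is known that for inconsistent $H$ with $V(H)\cap A(G)\neq\emptyset$, $\mathcal{P}_G(H)=\{V(H)\cap A(G)\}$. Convention: for each inconsistent $H$ with $V(H)\cap A(G)=\emptyset$, a formal copy of the empty set (a separate copy for each such $H$) is adjoined to $\mathcal{P}(G)$ and $\mathcal{P}_G(H)$ consists of this copy. Upper bounds. For $H\in\mathcal{G}(G)$, $U_G(H)$ (resp. $U^*_G(H)$) is the union of the vertex sets of all strict (resp. nonstrict) upper bounds of $H$ in $(\mathcal{G}(G),\triangleleft)$. It is known that for each connected component $K$ of $G[U_G(H)]$ there is $S\in\mathcal{P}_G(H)$ with $N_G(K)\cap V(H)\subseteq S$. For $S\in\mathcal{P}_G(H)$, $U_G(S)$ is the union of the vertex sets of those strict upper bounds of $H$ that are contained in a component $K$ of $G[U_G(H)]$ with $N_G(K)\cap V(H)\subseteq S$. Put ${}^{\top}U_G(S)=U^*_G(H)\setminus S\setminus U_G(S)$. For $H$ inconsistent and $S=V(H)\cap A(G)$ (possibly a formal copy of $\emptyset$), ${}^{\top}U_G(S)=V(H)\cap D(G)$. DM components. For $S\in\mathcal{P}(G)$,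 the DM component $K(S)$ with base $S$ is the subgraph $G[S\cup{}^{\top}U_G(S)]$ endowed with $S$ as an attribute; distinct bases give distinct DM components even if the subgraphs coincide. $\mathcal{D}(G)$ is the set of all DM components and $\pi(C)$ is the base of $C\in\mathcal{D}(G)$. A DM component $C$ is inconsistent if $\pi(C)\in\mathcal{P}_G(H)$ for some inconsistent factor-component $H$; $\mathcal{D}^-(G)$ is the set of inconsistent DM components. Relations on $\mathcal{D}(G)$. $D_1\preceq^{\circ}D_2$ if $D_1=D_2$ or $N_G({}^{\top}U_G(\pi(D_1)))\cap\pi(D_2)\ne\emptyset$. $D_1\preceq D_2$ if there are $C_1,\dots,C_k\in\mathcal{D}(G)$, $k\ge1$, with $C_1=D_1$, $C_k=D_2$ and $C_i\preceq^{\circ}C_{i+1}$ for $1\le i<k$. $D_1\smile^{\circ}D_2$ if $\pi(D_2)\neq\emptyset$ and $\pi(D_2)\subseteq V(D_1)\setminus\pi(D_1)$. $D_1\smile D_2$ if there is $D'\in\mathcal{D}(G)$ with $D_1\preceq D'$ and $D'\smile^{\circ}D_2$. The triple $(\mathcal{D}(G),\preceq,\smile)$ is a TFR poset: $\preceq$ is a partial order, $\smile$ is irreflexive and symmetric, and $x\preceq y$, $y\smile z$ imply $x\smile z$. Ideals. An upper ideal is a set $\mathcal{I}\subseteq\mathcal{D}(G)$ such that $x\in\mathcal{I}$ and $x\preceq y$ imply $y\in\mathcal{I}$. It is legitimate if no $x,y\in\mathcal{I}$ satisfy $x\smile y$. It is normalized if $\mathcal{I}=\mathcal{I}'\cup\mathcal{D}^-(G)$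 for some $\mathcal{I}'\subseteq\mathcal{D}(G)$, i.e. $\mathcal{D}^-(G)\subseteq\mathcal{I}$. A legitimate upper ideal $\mathcal{I}$ is spanning if every $x\in\mathcal{D}(G)\setminus\mathcal{I}$ satisfies $x\smile y$ for some $y\in\mathcal{I}$. *)

(* Defs.v *)
From mathcomp Require Import all_boot.

Set Implicit Arguments.
Unset Strict Implicit.
Unset Printing Implicit Defensive.

(* Only adjacency is recorded: parallel edges play no role in any notion used
   here. Loops are permitted, but they are never edges of a matching. *)
Record graph := Graph {
  vertex :> finType;
  adj : rel vertex;
  adj_sym : symmetric adj
}.

Section Construction.
Variable G : graph.
Implicit Types X : {set G}.

Definition induced_adj X (x y : {x : G | x \in X}) : bool :=
  adj (val x) (val y).

Lemma induced_adj_sym X : symmetric (@induced_adj X).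
Proof. by move=> x y; apply: adj_sym. Qed.

Definition induced X : graph := Graph (@induced_adj_sym X).

Definition delete X : graph := induced (~: X).

(* G / X for nonempty X: the new vertex is None. The loops and parallel edges
   created by the contraction are dropped. *)
Definition contract_adj X (x y : option {x : G | x \notin X}) : bool :=
  match x, y with
  | Some u, Some v => adj (val u) (val v)
  | Some u, None | None, Some u => [exists z in X, adj z (val u)]
  | None, None => false
  end.

Lemma contract_adj_sym X : symmetric (@contract_adj X).
Proof. by move=> [x|] [y|] //=; apply: adj_sym. Qed.

Definition contract X : graph := Graph (@contract_adj_sym X).

Definition neighbours X : {set G} :=
  [set y in ~: X | [exists x in X, adj x y]].

Definition components : {set {set G}} :=
  equivalence_partition (connect (@adj G)) [set: G].

End Construction.

Section Matching.
Variable G : graph.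
Implicit Types (x y : G) (X : {set G}) (M : {set {set G}}).

Definition edges : {set {set G}} :=
  [set E | [exists x, exists y, [&& adj x y, x != y & E == [set x; y]]]].

Definition matching M : bool := (M \subset edges) && trivIset M.

Definition nu : nat := \max_(M : {set {set G}} | matching M) #|M|.

(* The subtraction is never truncated, since 2 * nu <= #|G|. *)
Definition deficiency : nat := #|G| - 2 * nu.

Definition maximum_matching M : bool := matching M && (#|M| == nu).

Definition has_perfect_matching : bool :=
  [exists M : {set {set G}}, matching M && (cover M == [set: G])].

(* D(G) *)
Definition exposable : {set G} :=
  [set x | [exists M : {set {set G}}, maximum_matching M && (x \notin cover M)]].

(* A(G) *)
Definition exposable_nbrs : {set G} := neighbours exposable.

Definition odd_components X : nat :=
  #|[set C in components (delete X) | odd #|C|]|.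

(* def(G) = q_G(X) - |X|, where the right-hand side is an integer that may be
   negative. *)
Definition barrier X : bool := deficiency + #|X| == odd_components X.

Definition maximal_barrier X : bool := maxset barrier X.

Definition allowed x y : bool :=
  [exists M : {set {set G}}, maximum_matching M && ([set x; y] \in M)].

Definition factor_connected : rel G := connect allowed.

(* A factor-component is represented by its vertex set. *)
Definition factor_components : {set {set G}} :=
  equivalence_partition factor_connected [set: G].

Definition inconsistent (H : {set G}) : bool := H :&: exposable != set0.

(* Factor-components being pairwise disjoint, any union of them is a disjoint
   union. *)
Definition separating X : bool :=
  [exists P : {set {set G}}, (P \subset factor_components) && (X == cover P)].

End Matching.

Definition factor_critical (G : graph) : bool :=
  [forall x : G, has_perfect_matching (delete [set x])].

Section Basilica.
Variable G : graph.
Implicit Types (x y : G) (H S X : {set G}).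

(* The relation G1 <| G2 on vertex sets of factor-components. *)
Definition fc_le (H1 H2 : {set G}) : bool :=
  [exists X : {set G},
    [&& separating X, H1 :|: H2 \subset X &
        factor_critical
          (contract [set x : induced X | val x \in H1])]].

(* U_G(H) and U^*_G(H) *)
Definition upper H : {set G} :=
  \bigcup_(H' in factor_components G | fc_le H H' && (H' != H)) H'.

Definition upper_star H : {set G} :=
  \bigcup_(H' in factor_components G | fc_le H H') H'.

Definition kl_rel x y : bool :=
  (x == y) ||
  (factor_connected x y && (deficiency G < deficiency (delete [set x; y]))).

Definition kl_classes : {set {set G}} :=
  equivalence_partition kl_rel (~: exposable G).

(* P_G(H); the formal copy of the empty set attached to H is set0 here, and is
   told apart from the other copies in [bases] by pairing it with H. *)
Definition kl_of H : {set {set G}} :=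
  if inconsistent H && (H :&: exposable_nbrs G == set0) then [set set0]
  else [set S in kl_classes | S \subset H].

(* Vertex sets of the connected components of G[X] *)
Definition components_in X : {set {set G}} :=
  [set [set val x | x in C] | C : {set induced X} in components (induced X)].

(* U_G(S) for S in P_G(H) *)
Definition upper_of H S : {set G} :=
  \bigcup_(H' in factor_components G |
      [&& fc_le H H', H' != H &
          [exists K in components_in (upper H),
             (H' \subset K) && (neighbours K :&: H \subset S)]]) H'.

(* ^T U_G(S) for S in P_G(H); when H is inconsistent and S = V(H) :&: A(G), the
   value prescribed by the first branch is also that of the second formula. *)
Definition coupper_of H S : {set G} :=
  if inconsistent H && (S == H :&: exposable_nbrs G) then H :&: exposable G
  else upper_star H :\: S :\: upper_of H S.

(* P(G), each S in P_G(H) being tagged with H. A nonempty S lies in exactly one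
   H, so that only the copies of the empty set are affected by the tags. *)
Definition bases : {set {set G} * {set G}} :=
  [set b | (b.1 \in factor_components G) && (b.2 \in kl_of b.1)].

(* The DM component K(S) is determined by its base S. *)
Definition dm_component : finType := {b : {set G} * {set G} | b \in bases}.

Implicit Types C : dm_component.

Definition dm_base C : {set G} := (val C).2.

Definition dm_coupper C : {set G} := coupper_of (val C).1 (val C).2.

Definition dm_vertices C : {set G} := dm_base C :|: dm_coupper C.

(* D^-(G) *)
Definition dm_inconsistent : {set dm_component} :=
  [set C | inconsistent (val C).1].

Definition dm_le0 C1 C2 : bool :=
  (C1 == C2) || (neighbours (dm_coupper C1) :&: dm_base C2 != set0).

Definition dm_le : rel dm_component := connect dm_le0.

Definition dm_smile0 C1 C2 : bool :=
  (dm_base C2 != set0) && (dm_base C2 \subset dm_vertices C1 :\: dm_base C1).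

Definition dm_smile C1 C2 : bool :=
  [exists C : dm_component, dm_le C1 C && dm_smile0 C C2].

End Basilica.

Section Ideal.
Variables (P : finType) (le smile : rel P).
Implicit Types I : {set P}.

Definition upper_ideal I : Prop :=
  forall x y, x \in I -> le x y -> y \in I.

Definition legitimate I : Prop :=
  forall x y, x \in I -> y \in I -> ~~ smile x y.

Definition spanning I : Prop :=
  forall x, x \notin I -> exists2 y, y \in I & smile x y.

End Ideal.

Definition normalized (G : graph) (I : {set dm_component G}) : Prop :=
  dm_inconsistent G \subset I.

(* Main.v *)
(** Write D(G) for the exposable vertices and D(G - u), A(G - u) for the
    Gallai-Edmonds sets of G - u. For u, v outside D(G), say that u and v smile
    when def (G - u - v) = def G, i.e. when v lies in D(G - u). By exchanging
    matchings along alternating paths, a set disjoint from D(G) in which no two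
    vertices smile is extreme, i.e. def (G - X) = def G + #|X|, and by the
    Tutte-Berge formula for G - X an extreme set is contained in a barrier. So
    the maximal barriers are the maximal smile-free sets of vertices outside D(G).

    It remains to see that two DM components smile exactly when the vertices of
    their bases do. For a consistent factor-component H and u in a class S of H,
    the set ^T U_G(S) turns out to be the union of the components of D(G - u)
    that meet H. Since passing from u to z in A(G - u) shrinks D(G - u) to
    D(G - z), the set D(G - u) is, up to D(G), the union of the sets ^T U_G(S')
    over the classes S' above S. As the relation of smiling absorbs the order on
    its left, a spanning legitimate set of DM components is automatically a
    normalized upper ideal. *)

(* Deletion is encoded by exposure: [min_exposed X] minimises over the matchings exposing all of X,
   so every G - X lives on the vertex type of G and matchings of different G - X can be compared
   directly. Every exchange replaces one involution by another on a set invariant under both, and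
   only the fixed points in that set have to be counted. The number of exposed vertices always has
   the parity of the number of vertices, which is why costs come in steps of two. The obstacle is ^T
   U_G(S): it is defined by factor-critical contractions G[X]/H and by components of G[U_G(H)],
   neither of which mentions u or D(G - u). One inclusion builds a contraction from H and the
   components of D(G - u) that meet H. For the other, an arbitrary contraction is used only through
   a matching with at most def G + 2 exposed vertices that agrees on H with a given maximum
   matching. Two facts link this to D(G - u): a maximum matching leaves each component of D(G - u)
   at most once, and for components meeting H the exit lies in H. *)
Require Import Defs.
From mathcomp Require Import all_boot zify.

Set Implicit Arguments.
Unset Strict Implicit.
Unset Printing Implicit Defensive.

(** * Alternating orbits of two involutions *)

Section Involutions.
Variable T : finType.
Implicit Types (f g : T -> T) (x y z : T) (K Z : {set T}).

Definition exposed f := [set x | f x == x].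

Lemma exposedP f x : reflect (f x = x) (x \in exposed f).
Proof. by rewrite inE; apply: eqP. Qed.

Definition invariant_set f K := forall x, x \in K -> f x \in K.

Lemma invariant_mem f K x :
  involutive f -> invariant_set f K -> (f x \in K) = (x \in K).
Proof. by move=> fK fI; apply/idP/idP => /fI //; rewrite fK. Qed.

Lemma invariant_setC f K :
  involutive f -> invariant_set f K -> invariant_set f (~: K).
Proof. by move=> fK fI x; rewrite !inE invariant_mem. Qed.

Variant orbit_ends f g x K : Prop :=
| OrbitOdd y of y \in K & exposed f :&: K = [set y]
    & exposed g :&: K = [set x]
| OrbitEven y of y \in K & y != x & exposed f :&: K = set0
    & exposed g :&: K = [set x; y].

(* On the orbit of x under p = f o g, writing x_i = p^i x, the involution g is
   i |-> -i and f is i |-> 1 - i; their fixed points depend only on the parity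
   of the length of the orbit. *)
Lemma orbit_endsP f g x : involutive f -> involutive g -> g x = x ->
  exists K, [/\ x \in K, invariant_set f K, invariant_set g K,
    forall Z, invariant_set f Z -> invariant_set g Z -> x \in Z -> K \subset Z
    & orbit_ends f g x K].
Proof.
move=> fK gK gx; pose p y := f (g y).
have p_inj : injective p.
  by move=> y z yz; apply: (inv_inj gK); apply: (inv_inj fK).
pose n := order p x.
have n0 : 0 < n := order_gt0 p x.
have itn : iter n p x = x by apply: iter_order.
have it_inj i j : i < n -> j < n -> iter i p x = iter j p x -> i = j.
  by move=> lti ltj /(congr1 (findex p x)); rewrite !findex_iter.
have gi i : i <= n -> g (iter i p x) = iter (n - i) p x.
  elim: i => [|i IHi] lin; first by rewrite subn0 itn.
  rewrite iterS {1}/p IHi; last by lia.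
  have -> : n - i = (n - i.+1).+1 by lia.
  by rewrite iterS {1}/p fK gK.
have fi i : i <= n -> f (iter i p x) = iter (n - i).+1 p x.
  by move=> lin; rewrite iterS -gi // /p gK.
pose K := [set y | fconnect p x y].
have KP y : reflect (exists2 i, i < n & y = iter i p x) (y \in K).
  rewrite inE; apply: (iffP idP) => [cxy|[i _ ->]]; last exact: fconnect_iter.
  by exists (findex p x y); rewrite ?iter_findex // findex_max.
exists K; split.
- by rewrite inE connect0.
- by move=> _ /KP[i lin ->]; rewrite fi 1?ltnW // inE fconnect_iter.
- by move=> _ /KP[i lin ->]; rewrite gi 1?ltnW // inE fconnect_iter.
- move=> Z fZ gZ xZ; apply/subsetP=> _ /KP[i _ ->].
  by elim: i => //= i IHi; apply/fZ/gZ.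
have Kit i : iter i p x \in K by rewrite inE fconnect_iter.
have gfix i : i < n -> g (iter i p x) = iter i p x -> i = 0 \/ n = i + i.
  move=> lin; rewrite gi; last by lia.
  case: i lin => [|i] lin; first by left.
  by move=> /it_inj => E; right; have := E ltac:(lia) ltac:(lia); lia.
(* The indices 0 and 1 are treated apart, because n + 1 - i then falls outside the range [0, n)
   where iterates are distinct. *)
have ffix i : i < n -> f (iter i p x) = iter i p x ->
    n = 1 \/ n.+1 = i + i.
  move=> lin; rewrite fi; last by lia.
  case: i lin => [|i] lin.
    rewrite subn0 iterS itn => E; left.
    have [//|n1] : n = 1 \/ 1 < n by lia.
    by have := it_inj 1 0 n1 n0 E.
  case: i lin => [|i] lin.
    have -> : (n - 1).+1 = n by lia.
    by rewrite itn => /(it_inj 0 1 n0 lin).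
  by move=> /it_inj => E; right; have := E ltac:(lia) ltac:(lia); lia.
have [odn|evn] := boolP (odd n).
  pose m := n./2.
  have nE : n = m + m + 1 by have := odd_double_half n; rewrite odn -addnn; lia.
  (* For n = 1 this witness is x_1 = x itself. *)
  apply: (@OrbitOdd _ _ _ _ (iter m.+1 p x)) => //.
  - apply/setP=> y; rewrite !inE; apply/andP/eqP => [[/eqP fy yK]|->].
      have {yK} /KP[i lin yE] : y \in K by rewrite inE.
      rewrite yE in fy *; have [n1|ni] := ffix _ lin fy.
        have -> : i = 0 by lia.
        have -> : m.+1 = n by lia.
        by rewrite itn.
      by congr (iter _ p x); lia.
    rewrite fconnect_iter fi; last by lia.
    by split=> //; apply/eqP; congr (iter _ p x); lia.
  - apply/setP=> y; rewrite !inE; apply/andP/eqP => [[/eqP gy yK]|->].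
      have {yK} /KP[i lin yE] : y \in K by rewrite inE.
      by rewrite yE in gy *; have [->//|] := gfix _ lin gy; lia.
    by rewrite gx eqxx connect0.
pose m := n./2.
have nE : n = m + m.
  by have := odd_double_half n; rewrite (negbTE evn) -addnn; lia.
apply: (@OrbitEven _ _ _ _ (iter m p x)) => //.
- apply/eqP=> /(it_inj m 0 ltac:(lia) n0); lia.
- apply/setP=> y; rewrite !inE; apply/andP => [[/eqP fy yK]].
  have {yK} /KP[i lin yE] : y \in K by rewrite inE.
  by rewrite yE in fy; have [|] := ffix _ lin fy; lia.
apply/setP=> y; rewrite !inE; apply/andP/orP => [[/eqP gy yK]|[]/eqP->].
- have {yK} /KP[i lin yE] : y \in K by rewrite inE.
  rewrite yE in gy *; have [->|ni] := gfix _ lin gy; first by left.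
  by right; apply/eqP; congr (iter _ p x); lia.
- by rewrite gx eqxx connect0.
rewrite fconnect_iter gi; last by lia.
by split=> //; apply/eqP; congr (iter _ p x); lia.
Qed.

(** The pairs {x, f x} with f x != x can be removed from K one after the other. *)
Lemma odd_exposed f K : involutive f -> invariant_set f K ->
  odd #|K| = odd #|exposed f :&: K|.
Proof.
move=> fK; have [k] := ubnP #|K|; elim: k K => // k IHk K ltK fI.
have [/subsetP sub|] := boolP (K \subset exposed f).
  congr (odd #|pred_of_set _|); apply/setP=> x; rewrite inE.
  by have [xK|_] := boolP (x \in K); rewrite ?andbF // sub.
case/subsetPn=> x xK; rewrite inE => fx.
pose K' := K :\: [set x; f x].
have fI' : invariant_set f K'.
  move=> y; rewrite !inE => /andP[/norP[yx yfx] yK].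
  by rewrite negb_or (inj_eq (inv_inj fK)) yx (can2_eq fK fK) yfx fI.
have subxK : [set x; f x] \subset K.
  by apply/subsetP=> y; rewrite !inE => /orP[]/eqP->; rewrite ?fI.
have cK : #|K| = #|K'| + 2.
  rewrite /K' cardsD (setIidPr subxK) cards2 eq_sym fx.
  by have := subset_leq_card subxK; rewrite cards2 eq_sym fx; lia.
have -> : exposed f :&: K = exposed f :&: K'.
  apply/setP=> y; rewrite !inE; case: (f y =P y) => //= fy.
  case: (y =P x) => [yx|_]; first by rewrite -yx fy eqxx in fx.
  case: (y =P f x) => [yx|_] //.
  by move: fy; rewrite yx fK => E; rewrite -E eqxx in fx.
rewrite -IHk //; first by rewrite cK oddD addbF.
by lia.
Qed.

End Involutions.

(** * Matchings as involutions, and the Gallai-Edmonds sets *)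

Section Mates.
Variables (T : finType) (e : rel T).
Hypothesis e_sym : symmetric e.
Implicit Types (f g h : {ffun T -> T}) (x y z a v : T) (K X Y : {set T}).

(* A matching is encoded by the involution exchanging the ends of its edges. *)
Definition mate f :=
  [forall x, (f (f x) == x) && ((f x == x) || e x (f x))].

Lemma mateP f :
  reflect (involutive f /\ forall x, f x != x -> e x (f x)) (mate f).
Proof.
apply: (iffP forallP) => [H|[fK fe] x]; last first.
  by rewrite fK eqxx; case: eqP => // /eqP; apply: fe.
split=> [x|x fx]; have /andP[/eqP fK] := H x; first by [].
by rewrite (negbTE fx).
Qed.

Lemma mateK f : mate f -> involutive f.
Proof. by case/mateP. Qed.

Lemma mate_adj f x : mate f -> f x != x -> e x (f x).
Proof. by case/mateP=> _; apply. Qed.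

(** Exchange of f along alternating paths: with K invariant under both f and g, it is a union of
    components of their symmetric difference. *)
Definition swap f g K : {ffun T -> T} :=
  [ffun x => if x \in K then g x else f x].

Lemma swap_mate f g K : mate f -> mate g ->
  invariant_set f K -> invariant_set g K -> mate (swap f g K).
Proof.
move=> mf mg fI gI; apply/mateP; split=> [x|x]; rewrite !ffunE.
  have [xK|xK] := boolP (x \in K); first by rewrite gI // (mateK mg).
  by rewrite (invariant_mem _ (mateK mf) fI) (negbTE xK) (mateK mf).
by case: ifP => _; apply: mate_adj.
Qed.

Lemma exposed_swap f g K :
  exposed (swap f g K) = (exposed f :\: K) :|: (exposed g :&: K).
Proof.
by apply/setP=> x; rewrite !inE ffunE; case: (x \in K);
  rewrite ?andbF ?orbF ?andbT.
Qed.

Lemma card_exposed_swap f g K :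
  #|exposed (swap f g K)| + #|exposed f :&: K| =
  #|exposed f| + #|exposed g :&: K|.
Proof.
rewrite exposed_swap cardsU.
have -> : (exposed f :\: K) :&: (exposed g :&: K) = set0.
  by apply/setP=> x; rewrite !inE; case: (x \in K); rewrite ?andbF.
by rewrite cards0 -(cardsID K (exposed f)); lia.
Qed.

Lemma sub_exposed_swap f g K X : X \subset exposed f -> X \subset exposed g ->
  X \subset exposed (swap f g K).
Proof.
move=> /subsetP Xf /subsetP Xg; apply/subsetP=> x xX; move: (Xf x xX) (Xg x xX).
by rewrite !inE ffunE; case: ifP.
Qed.

(* Removes the edges with an end in Y; hence cut f (~: Y) restricts f to Y. *)
Definition cut f Y : {ffun T -> T} :=
  [ffun x => if (x \in Y) || (f x \in Y) then x else f x].

Lemma cut_mate f Y : mate f -> mate (cut f Y).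
Proof.
move=> mf; apply/mateP; split=> [x|x]; rewrite !ffunE.
  have [xY|xY] := boolP ((x \in Y) || (f x \in Y)); first by rewrite xY.
  by rewrite (mateK mf) orbC (negbTE xY).
by case: ifP => [_|_]; rewrite ?eqxx //; apply: mate_adj.
Qed.

Lemma mem_exposed_cut f Y x :
  (x \in exposed (cut f Y)) = [|| f x == x, x \in Y | f x \in Y].
Proof.
rewrite !inE ffunE; case: ifP => [|]; first by rewrite eqxx orbT.
by rewrite orbF.
Qed.

Lemma sub_exposed_cut f Y : exposed f \subset exposed (cut f Y).
Proof. by apply/subsetP=> x; rewrite mem_exposed_cut inE => ->. Qed.

(** Each vertex of Y not yet exposed costs at most itself and its mate; those already exposed are
    free, and this saving is what later counts rely on. *)
Lemma card_exposed_cut f Y : involutive f ->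
  #|exposed (cut f Y)| <= #|exposed f| + 2 * #|Y :\: exposed f|.
Proof.
move=> fK.
have sub : exposed (cut f Y) \subset
    exposed f :|: ((Y :\: exposed f) :|: f @: (Y :\: exposed f)).
  apply/subsetP=> x; rewrite mem_exposed_cut !inE.
  case: (f x =P x) => //= /eqP fx; case: (x \in Y) => //= fxY.
  apply/imsetP; exists (f x); rewrite ?fK // !inE fxY andbT.
  by rewrite fK eq_sym.
have := subset_leq_card sub.
have := (leq_card_setU (exposed f) ((Y :\: exposed f) :|: f @: (Y :\: exposed
  f))).1.
have := (leq_card_setU (Y :\: exposed f) (f @: (Y :\: exposed f))).1.
have := leq_imset_card f (Y :\: exposed f).
lia.
Qed.

Definition join f x y : {ffun T -> T} :=
  [ffun z => if z == x then y else if z == y then x else f z].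

Lemma join_mate f x y : mate f -> f x = x -> f y = y -> x != y -> e x y ->
  mate (join f x y).
Proof.
move=> mf fx fy xy exy; have fK := mateK mf.
apply/mateP; split=> [z|z]; rewrite !ffunE.
  case: (z =P x) => [->|/eqP zx]; first by rewrite eq_sym (negbTE xy) eqxx.
  case: (z =P y) => [->|/eqP zy]; first by rewrite eqxx.
  by rewrite !(can2_eq fK fK) fx fy (negbTE zx) (negbTE zy) fK.
case: (z =P x) => [-> //|_]; case: (z =P y) => [->|_]; first by rewrite e_sym.
exact: mate_adj.
Qed.

Lemma exposed_join f x y : x != y ->
  exposed (join f x y) = exposed f :\: [set x; y].
Proof.
move=> xy; apply/setP=> z; rewrite !inE ffunE.
case: (z =P x) => [->|_]; first by rewrite eq_sym (negbTE xy).
by case: (z =P y) => [->|_]; rewrite //= (negbTE xy).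
Qed.

Lemma card_exposed_join f x y : f x = x -> f y = y -> x != y ->
  #|exposed (join f x y)| + 2 = #|exposed f|.
Proof.
move=> fx fy xy; rewrite exposed_join // cardsD.
have sub : [set x; y] \subset exposed f.
  by apply/subsetP=> z; rewrite !inE => /orP[]/eqP->; rewrite ?fx ?fy.
by have := subset_leq_card sub; rewrite (setIidPr sub) cards2 xy; lia.
Qed.

Lemma id_mate : mate [ffun x => x].
Proof. by apply/mateP; split=> x; rewrite !ffunE ?eqxx. Qed.

(* For X = set0 this is the deficiency; in general it is def(G - X) + |X|. *)
Definition min_exposed X :=
  #|exposed [arg min_(f < [ffun x => x] | mate f && (X \subset exposed f))
       #|exposed f|]|.

Lemma min_exposed_spec X :
  (exists f, [/\ mate f, X \subset exposed f & #|exposed f| = min_exposed X]) /\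
  (forall f, mate f -> X \subset exposed f -> min_exposed X <= #|exposed f|).
Proof.
rewrite /min_exposed; case: arg_minnP => [|f /andP[mf Xf] fmin].
  by rewrite id_mate; apply/subsetP=> x _; rewrite inE ffunE.
split; first by exists f.
by move=> g mg Xg; apply: fmin; rewrite mg.
Qed.

Lemma min_exposed_le X f : mate f -> X \subset exposed f ->
  min_exposed X <= #|exposed f|.
Proof. by have [_] := min_exposed_spec X; apply. Qed.

Definition optimal X f :=
  [&& mate f, X \subset exposed f & #|exposed f| <= min_exposed X].

Lemma optimal_ex X : exists f, optimal X f.
Proof.
by have [[f [mf Xf fE]] _] := min_exposed_spec X; exists f;
  rewrite /optimal mf Xf fE /=.
Qed.

Lemma optimal_mate X f : optimal X f -> mate f.
Proof. by case/and3P. Qed.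

Lemma optimal_sub X f : optimal X f -> X \subset exposed f.
Proof. by case/and3P. Qed.

Lemma optimal_card X f : optimal X f -> #|exposed f| = min_exposed X.
Proof. by case/and3P=> mf Xf le; apply/eqP;
  rewrite eqn_leq le min_exposed_le. Qed.

Lemma optimal_fix X f x : optimal X f -> x \in X -> f x = x.
Proof. by move=> /optimal_sub/subsetP fX /fX /exposedP. Qed.

Lemma odd_exposedT f : mate f -> odd #|exposed f| = odd #|T|.
Proof.
move=> mf; have := @odd_exposed _ f [set: T] (mateK mf) _.
by rewrite setIT cardsT => ->.
Qed.

Lemma odd_min_exposed X : odd (min_exposed X) = odd #|T|.
Proof.
by have [f mf] := optimal_ex X;
  rewrite -(optimal_card mf) odd_exposedT ?(optimal_mate mf).
Qed.

(* D(G - X) together with X itself, since vertices are deleted by being required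
   to be exposed; missable_rest X is D(G - X) and missable_nbrs X is A(G - X).
     *)
Definition missable X := [set x | [exists f, optimal X f && (f x == x)]].

Local Notation D := missable.

Lemma missableP X x : reflect (exists2 f, optimal X f & f x = x) (x \in D X).
Proof.
rewrite inE; apply: (iffP existsP) => [[f /andP[mf /eqP fx]]|[f mf fx]].
  by exists f.
by exists f; rewrite mf fx /=.
Qed.

Lemma D_mate X f x : mate f -> X \subset exposed f ->
  #|exposed f| <= min_exposed X -> f x = x -> x \in D X.
Proof. by move=> mf Xf le fx; apply/missableP; exists f => //; apply/and3P. Qed.

Lemma optimal_mem X f x : optimal X f -> x \notin D X -> f x != x.
Proof.
by move=> mf; apply: contra => /eqP fx; apply/missableP; exists f.
Qed.

Lemma sub_D X : X \subset D X.
Proof.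
apply/subsetP=> x xX; have [f mf] := optimal_ex X.
by apply/missableP; exists f => //; apply: optimal_fix xX.
Qed.

Definition missable_rest X := D X :\: X.

Local Notation Dm := missable_rest.

Definition missable_nbrs X :=
  [set a | (a \notin D X) && [exists y in Dm X, e y a]].

Local Notation A := missable_nbrs.

Lemma missable_nbrsP X a :
  reflect (a \notin D X /\ exists2 y, y \in Dm X & e y a) (a \in A X).
Proof.
have AE : (a \in A X) = (a \notin D X) && [exists y in Dm X, e y a].
  by rewrite in_set.
by rewrite AE; apply: (iffP andP) => -[aD yP]; split=> //; apply/exists_inP.
Qed.

(** * Gallai's lemma and the stability of D(G - X) *)

Definition tie X x y :=
  forall f, optimal X f -> f x = x -> f y = y -> x = y.

(* Gallai's lemma: if f exposes x and z, exchanging f along its alternating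
   path from y with a matching exposing y leaves x or z exposed. *)
Lemma tie_trans X x y z :
  y \in D X -> tie X x y -> tie X y z -> tie X x z.
Proof.
move=> /missableP[g mg gy] txy tyz f mf fx fz.
have [fy|/eqP fy] := f y =P y; first by rewrite (txy f) // -(tyz f).
apply/eqP; case: eqP => // xz; exfalso.
have [mf' mg'] := (optimal_mate mf, optimal_mate mg).
have [K [yK fI gI _ ends]] :=
  orbit_endsP (mateK mf') (mateK mg') gy.
(* A path with both ends exposed by g would be augmenting for g. *)
case: ends => [w wK fE gE|w wK wy fE gE]; last first.
  have := card_exposed_swap g f K; rewrite fE gE cards0 cards2 eq_sym wy.
  have := min_exposed_le (swap_mate mg' mf' gI fI)
    (sub_exposed_swap K (optimal_sub mg) (optimal_sub mf)).
  by rewrite (optimal_card mg); lia.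
pose h := swap f g K.
have mh : optimal X h.
  rewrite /optimal swap_mate // sub_exposed_swap ?(optimal_sub mf)
    ?(optimal_sub mg) //=.
  by have := card_exposed_swap f g K;
    rewrite fE gE !cards1 (optimal_card mf) /h; lia.
have hy : h y = y by rewrite ffunE yK.
have hfix u : f u = u -> u != w -> h u = u.
  move=> fu uw; rewrite ffunE; case: ifP => // uK.
  by move/setP: fE => /(_ u); rewrite !inE fu eqxx uK (negbTE uw).
have [xw|/eqP xw] := x =P w.
  have zw : z != w by rewrite -xw; apply/eqP=> zx; case: xz.
  by have yz := tyz h mh hy (hfix z fz zw); case/eqP: fy; rewrite yz.
by have xy := txy h mh (hfix x fx xw) hy; case/eqP: fy; rewrite -xy.
Qed.

Definition rel_in X x y := [&& x \in X, y \in X & e x y].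

(** Adjacent vertices of D(G - X) are tied, since an optimal matching exposing both could be
    enlarged by their edge without covering X; transitivity carries this along paths. So an optimal
    matching exposes at most one vertex of each component of D(G - X). *)
Lemma tie_connect X x y : x \in Dm X -> connect (rel_in (Dm X)) x y -> tie X x
  y.
Proof.
move=> xD /connectP[p]; elim/last_ind: p y => [|p w IHp] y /=.
  by move=> _ -> f _ _ _.
rewrite rcons_path last_rcons => /andP[px /and3P[uD wD uw]] ->.
have Dsub := subsetP (subsetDl (D X) X).
apply: (@tie_trans _ _ (last x p)); [exact: Dsub|exact: IHp|].
move=> f mf fu fw; apply/eqP; apply/contraT => neq.
have := card_exposed_join fu fw neq.
suff : min_exposed X
  <= #|exposed (join f (last x p) w)| by rewrite (optimal_card mf); lia.
apply: min_exposed_le; first by rewrite join_mate ?(optimal_mate mf).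
rewrite exposed_join // subsetD (optimal_sub mf) /=.
rewrite disjoint_sym disjoint_subset; apply/subsetP=> v.
by rewrite !inE => /orP[]/eqP->; [move: uD|move: wD]; rewrite inE => /andP[].
Qed.

(** Cutting an optimal matching at a costs at most 2; a cost of 0 would make a missable, and parity
    excludes 1. *)
Lemma min_exposedU1 X a : a \notin D X -> min_exposed (a |: X) = min_exposed X
  + 2.
Proof.
move=> aD; have [g mg] := optimal_ex X; apply/eqP; rewrite eqn_leq.
have mg' := optimal_mate mg.
have -> /= : min_exposed (a |: X) <= min_exposed X + 2.
  apply: leq_trans (@min_exposed_le _ (cut g [set a]) _ _) _;
    first exact: cut_mate.
    apply/subUsetP; split;
      last exact: subset_trans (optimal_sub mg) (sub_exposed_cut _ _).
    by apply/subsetP=> x /set1P->; rewrite mem_exposed_cut set11 orbT.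
  apply: leq_trans (card_exposed_cut _ (mateK mg')) _.
  rewrite (optimal_card mg).
  by have := subset_leq_card (subsetDl [set a] (exposed g)); rewrite cards1;
    lia.
have [h mh] := optimal_ex (a |: X).
have /subUsetP[ah Xh] := optimal_sub mh.
have := min_exposed_le (optimal_mate mh) Xh;
  rewrite (optimal_card mh) leq_eqVlt => /orP[/eqP E|].
  case/negP: aD; apply: (D_mate (optimal_mate mh) Xh).
    by rewrite (optimal_card mh) E.
  by apply/exposedP; move: ah; rewrite sub1set.
rewrite leq_eqVlt => /orP[/eqP E|]; last by lia.
by have := odd_min_exposed (a |: X); rewrite -E /= odd_min_exposed; case: odd.
Qed.

(* The stability lemma. *)
Lemma Dm_A1 X a : a \in A X -> Dm (a |: X) = Dm X.
Proof.
move=> aA; have /missable_nbrsP[aD [y yDm eya]] := aA;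
  have min_exposedE := min_exposedU1 aD.
have XD := subsetP (sub_D X).
have aX : a \notin X by apply: contra aD; apply: XD.
move: yDm; rewrite inE => /andP[yX yD].
apply/setP=> v; rewrite [LHS]inE [RHS]inE in_setU1 negb_or -andbA andbCA.
have [vX|vX] //= := boolP (v \in X).
apply/andP/idP => [[va /missableP[h mh hv]]|vD]; last first.
  split; first by apply: contraNneq aD => <-.
  have /missableP[f mf fv] := vD; have mf' := optimal_mate mf.
  apply: (@D_mate _ (cut f [set a])); first exact: cut_mate.
  - apply/subUsetP; split;
      last exact: subset_trans (optimal_sub mf) (sub_exposed_cut _ _).
    by apply/subsetP=> x /set1P->; rewrite mem_exposed_cut set11 orbT.
  - apply: leq_trans (card_exposed_cut _ (mateK mf')) _.
    rewrite min_exposedE (optimal_card mf).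
    by have := subset_leq_card (subsetDl [set a] (exposed f)); rewrite cards1;
      lia.
  - by apply/exposedP; rewrite (subsetP (sub_exposed_cut _ _)) // inE fv.
apply: contraT => vD; have /missableP[g mg gy] := yD.
have [mg' mh'] := (optimal_mate mg, optimal_mate mh).
have /subUsetP[ah Xh] := optimal_sub mh.
have {ah} ha : h a = a by apply/exposedP; move: ah; rewrite sub1set.
have [K [vK gI hI _ ends]] := orbit_endsP (mateK mg') (mateK mh') hv.
have XE := sub_exposed_swap K (optimal_sub mg) Xh.
have XE' := sub_exposed_swap K Xh (optimal_sub mg).
have cg := optimal_card mg; have ch := optimal_card mh.
case: ends => [w wK gE hE|w wK wv gE hE].
  case/negP: vD; apply: (@D_mate _ (swap g h K)) => //; first exact: swap_mate.
    by have := card_exposed_swap g h K; rewrite gE hE !cards1 cg; clear; lia.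
  by rewrite ffunE vK.
(* If the path from v misses a, exchanging h along it saves two exposed vertices and keeps a
   exposed, so a would be missable. *)
have [aK|aK] := boolP (a \in K); last first.
  case/negP: aD; apply: (@D_mate _ (swap h g K)) => //; first exact: swap_mate.
    have := card_exposed_swap h g K; rewrite gE hE cards0 cards2 eq_sym wv.
    by rewrite ch min_exposedE /=; clear; lia.
  by rewrite ffunE (negbTE aK).
have yK : y \notin K.
  by apply/negP=> yK; move/setP: gE => /(_ y); rewrite !inE gy eqxx yK.
(* Now [h1] exposes v, a and y, two vertices more than the optimum; adding the edge y -- a makes it
   optimal again with v still exposed. *)
pose h1 := swap g h K.
have ya : y != a by apply: contraNneq aD => <-.
have h1y : h1 y = y by rewrite ffunE (negbTE yK).
have h1a : h1 a = a by rewrite ffunE aK.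
have mh1 : mate h1 by apply: swap_mate.
case/negP: vD; apply: (@D_mate _ (join h1 y a)).
- exact: join_mate.
- rewrite exposed_join // subsetD XE /= disjoint_sym disjoint_subset.
  by apply/subsetP=> x; rewrite !inE => /orP[]/eqP->.
- have := card_exposed_join h1y h1a ya.
  have := card_exposed_swap g h K; rewrite gE hE cards0 cards2 eq_sym wv cg.
  by rewrite /h1 /=; clear; lia.
- rewrite ffunE (negbTE va); have -> : (v == y) = false.
    by apply/eqP=> vy; rewrite vy in vK; rewrite vK in yK.
  by rewrite ffunE vK.
Qed.

Lemma D_Dm X : D X = Dm X :|: X.
Proof.
apply/setP=> x; rewrite in_setU in_setD.
by have := subsetP (sub_D X) x; case: (x \in X) => [->|] //=; rewrite orbF.
Qed.

Lemma A_notin X a : a \in A X -> a \notin X.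
Proof. by case/missable_nbrsP=> aD _; apply: contra aD;
  apply/subsetP/sub_D. Qed.

Lemma A_notin_Dm X a : a \in A X -> a \notin Dm X.
Proof. by case/missable_nbrsP=> aD _; rewrite inE (negbTE aD) andbF. Qed.

(** Iterated stability: D(G - X) does not change when vertices of A(G - X) are deleted, so the
    remaining ones stay in A and each costs a further 2. *)
Lemma A_stable X Y :
  Y \subset A X -> min_exposed (Y :|: X) = min_exposed X + 2 * #|Y|
    /\ Dm (Y :|: X) = Dm X.
Proof.
have [k] := ubnP #|Y|; elim: k Y => // k IHk Y ltY sub.
have [->|[a aY]] := set_0Vmem Y; first by rewrite set0U cards0 addn0.
have aA := subsetP sub a aY; have /missable_nbrsP[aD [y yD eya]] := aA.
have cY := cardsD1 a Y; rewrite aY in cY.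
have [||m0 D0] := IHk (Y :\ a); first by lia.
  exact: subset_trans (subsetDl _ _) sub.
rewrite -(setD1K aY) -setUA.
have aA' : a \in A (Y :\ a :|: X).
  apply/missable_nbrsP; split; last by exists y => //; rewrite D0.
  by rewrite D_Dm D0 !in_setU in_setD1 eqxx /= negb_or A_notin_Dm ?A_notin.
rewrite (min_exposedU1 (proj1 (missable_nbrsP _ _ aA'))) (Dm_A1 aA') m0 D0
  setD1K // cY.
by split=> //; lia.
Qed.

(** Exposed vertices and vertices matched out of D(G - X) are treated alike, because cutting at A(G
    - X) turns the second kind into the first. *)
Definition irregular X f x := (f x == x) || (f x \notin Dm X).

(** Cut at A(G - X), f becomes optimal for [A X :|: X] and exposes both x and z; as D is unchanged
    by stability, they are tied. The set Y admits matchings that already expose a part of A(G -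
    X). *)
Lemma irregular_uniq X Y f x z : Y \subset A X -> optimal (Y :|: X) f ->
  x \in Dm X -> connect (rel_in (Dm X)) x z ->
  irregular X f x -> irregular X f z -> x = z.
Proof.
move=> YA mf xD xz ix iz; have mf' := optimal_mate mf.
have zD : z \in Dm X.
  have /connectP[p] := xz; case/lastP: p => [|p w]; first by move=> _ ->.
  by rewrite rcons_path last_rcons => /andP[_ /and3P[_ wD _]] ->.
have [mY DY] := A_stable YA; have [mA DA] := A_stable (subxx (A X)).
have /subUsetP[Yf Xf] := optimal_sub mf.
(* The vertices of Y being exposed already, the cut costs at most twice #|A X| - #|Y|, which is the
   gap between the two optima in [A_stable]. *)
have mcut : optimal (A X :|: X) (cut f (A X)).
  rewrite /optimal cut_mate //=; apply/andP; split.
    apply/subUsetP; split; last exact: subset_trans Xf (sub_exposed_cut _ _).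
    by apply/subsetP=> a aA; rewrite mem_exposed_cut aA orbT.
  apply: leq_trans (card_exposed_cut _ (mateK mf')) _.
  rewrite (optimal_card mf) mY mA.
  have : A X :\: exposed f \subset A X :\: Y by apply: setDS.
  move/subset_leq_card; rewrite (cardsD _ Y) (setIidPr YA).
  by have := subset_leq_card YA; lia.
have tx : tie (A X :|: X) x z.
  by apply: tie_connect; rewrite ?DA // /rel_in DA.
have irr_fix v : v \in Dm X -> irregular X f v -> cut f (A X) v = v.
  move=> vD; rewrite /irregular => iv; apply/exposedP; rewrite mem_exposed_cut.
  case/orP: iv => [-> //|fvD].
  have [-> //|/eqP fv] := f v =P v.
  suff -> : f v \in A X by rewrite !orbT.
  apply/missable_nbrsP; split; last by exists v => //; rewrite mate_adj.
  rewrite D_Dm inE (negbTE fvD) /=; apply: contra fv => /(subsetP Xf)/exposedP.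
  by rewrite (mateK mf') => <-.
by apply: tx mcut _ _; apply: irr_fix.
Qed.

(** Cutting f at a yields an optimal matching for [a |: X] that exposes f a; by stability D is the
    same for X. *)
Lemma mate_A X f a : optimal X f -> a \in A X -> f a \in Dm X.
Proof.
move=> mf aA; have /missable_nbrsP[aD _] := aA; have fa := optimal_mem mf aD.
have mf' := optimal_mate mf; rewrite -(Dm_A1 aA) in_setD in_setU1 negb_or fa /=.
apply/andP; split.
  by apply: contra fa => /(optimal_fix mf); rewrite (mateK mf') => <-.
apply: (@D_mate _ (cut f [set a])); first exact: cut_mate.
- apply/subUsetP; split;
    last exact: subset_trans (optimal_sub mf) (sub_exposed_cut _ _).
  by apply/subsetP=> x /set1P->; rewrite mem_exposed_cut set11 orbT.
- apply: leq_trans (card_exposed_cut _ (mateK mf')) _.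
  rewrite min_exposedU1 // (optimal_card mf).
  by have := subset_leq_card (subsetDl [set a] (exposed f)); rewrite cards1;
    lia.
by apply/exposedP; rewrite mem_exposed_cut (mateK mf') set11 !orbT.
Qed.

End Mates.

(** * Barriers and extreme sets *)

Section Barriers.
Variables (T : finType) (e : rel T).
Hypothesis e_sym : symmetric e.
Implicit Types (f g h : {ffun T -> T}) (x y z a u v : T) (C K X Y Z : {set T}).

Local Notation mate := (mate e).
Local Notation min_exposed := (min_exposed e).
Local Notation optimal := (optimal e).
Local Notation D := (missable e).
Local Notation Dm := (missable_rest e).
Local Notation A := (missable_nbrs e).
Local Notation rel_in := (rel_in e).

Lemma rel_in_sym Z : symmetric (rel_in Z).
Proof. by move=> x y; rewrite /rel_in e_sym andbCA. Qed.

Definition component Z x := [set y | connect (rel_in Z) x y].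

Lemma component_refl Z x : x \in component Z x.
Proof. by rewrite inE connect0. Qed.

Lemma component_eq Z x y : y \in component Z x -> component Z y = component Z x.
Proof.
rewrite inE => xy; apply/setP=> z; rewrite !inE.
by rewrite (same_connect (sym_connect_sym (rel_in_sym Z)) xy).
Qed.

Lemma component_adj Z x y z :
  y \in component Z x -> y \in Z -> z \in Z -> e y z -> z \in component Z x.
Proof.
rewrite !inE => xy yZ zZ yz; apply: connect_trans xy _; apply: connect1.
by rewrite /rel_in yZ zZ.
Qed.

(** The form in which components are bounded from above: exhibit a set that no edge of Z leaves. *)
Lemma component_min Z C x : x \in C ->
  (forall y z, y \in C -> y \in Z -> z \in Z -> e y z -> z \in C) ->
  component Z x \subset C.
Proof.
move=> xC CI; apply/subsetP=> y; rewrite inE => /connectP[p].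
elim/last_ind: p y => [|p w IHp] y /=; first by move=> _ ->.
rewrite rcons_path last_rcons => /andP[px /and3P[lZ wZ lw]] ->.
exact: CI (IHp _ px erefl) lZ wZ lw.
Qed.

Lemma component_sub Z x : x \in Z -> component Z x \subset Z.
Proof. by move=> xZ; apply: component_min. Qed.

Lemma component_subset Z Z' x :
  Z \subset Z' -> component Z x \subset component Z' x.
Proof.
move=> /subsetP sub; apply: component_min; first exact: component_refl.
by move=> y z yC /sub yZ /sub zZ; apply: component_adj.
Qed.

(** * Odd components and the Tutte-Berge formula *)

Definition component_family Z := component Z @: Z.

Definition odd_family Y := [set K in component_family (~: Y) | odd #|K|].

(** The easy half of Tutte-Berge: as Y is exposed, f preserves each component of G - Y, and parity
    leaves an exposed vertex in every odd one. *)
Lemma card_odd_family f Y : mate f -> Y \subset exposed f ->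
  #|Y| + #|odd_family Y| <= #|exposed f|.
Proof.
move=> mf Yf; have fK := mateK mf.
suff : odd_family Y \subset component (~: Y) @: (exposed f :\: Y).
  move/subset_leq_card;
    have := leq_imset_card (component (~: Y)) (exposed f :\: Y).
  rewrite cardsD (setIidPr Yf).
  by have := subset_leq_card Yf; lia.
apply/subsetP=> K; rewrite inE => /andP[/imsetP[x xY ->]].
have Kinv : invariant_set f (component (~: Y) x).
  move=> y yK; have [->//|/eqP fy] := f y =P y.
  have yY := subsetP (component_sub xY) y yK; apply: component_adj yK yY _ _;
    last exact: mate_adj.
  rewrite inE; apply: contra fy => /(subsetP Yf)/exposedP.
  by rewrite fK => <-.
rewrite (odd_exposed fK Kinv) => oddK.
have : exposed f :&: component (~: Y) x != set0.
  by apply: contraTneq oddK => ->; rewrite cards0.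
case/set0Pn=> z /setIP[fz zK]; apply/imsetP; exists z.
  by rewrite inE fz -in_setC (subsetP (component_sub xY)).
by rewrite (component_eq zK).
Qed.

Lemma min_exposed_le2 Y : min_exposed Y <= min_exposed set0 + 2 * #|Y|.
Proof.
have [f mf] := optimal_ex e set0; have mf' := optimal_mate mf.
apply: leq_trans (@min_exposed_le _ _ _ (cut f Y) _ _) _; first exact: cut_mate.
  by apply/subsetP=> x xY; rewrite mem_exposed_cut xY orbT.
apply: leq_trans (card_exposed_cut _ (mateK mf')) _.
by rewrite (optimal_card mf);
  have := subset_leq_card (subsetDl Y (exposed f)); lia.
Qed.

Lemma odd_family_le Y : #|odd_family Y| <= min_exposed set0 + #|Y|.
Proof.
have [f mf] := optimal_ex e Y.
have := card_odd_family (optimal_mate mf) (optimal_sub mf);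
  rewrite (optimal_card mf).
by have := min_exposed_le2 Y; lia.
Qed.

(** All neighbours of D(G - X) lie in D(G - X), A(G - X) or X. *)
Lemma component_Dm X x : x \in Dm X ->
  component (~: (A X :|: X)) x = component (Dm X) x.
Proof.
move=> xD; apply/eqP; rewrite eqEsubset; apply/andP; split; last first.
  apply: component_subset; apply/subsetP=> y yD;
    rewrite in_setC in_setU negb_or.
  by rewrite (contraL (@A_notin_Dm _ e X y) yD) /=; move: yD => /setDP[].
apply: component_min => [|y z yC _ zAX yz]; first exact: component_refl.
have yD := subsetP (component_sub xD) y yC; apply: (component_adj yC yD _ yz).
move: zAX; rewrite in_setC in_setU negb_or => /andP[zA zX].
apply: contraR zA => zD; apply/missable_nbrsP; split; last by exists y.
by rewrite D_Dm in_setU (negbTE zX) orbF.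
Qed.

Lemma mate_component_Dm X f x y : mate f -> x \in Dm X -> y \in component (Dm
  X) x ->
  ~~ irregular e X f y -> f y \in component (Dm X) x.
Proof.
move=> mf xD yK; rewrite negb_or negbK => /andP[fy fyD].
by apply: (component_adj yK _ fyD (mate_adj mf fy));
  apply: subsetP (component_sub xD) y yK.
Qed.

(** The hard half of Tutte-Berge: the exposed vertices outside X and the mates of A(G - X) are
    irregular vertices of D(G - X), so they lie in distinct components, all of them odd. *)
Lemma card_odd_family_A X : min_exposed X + #|A X|
  <= #|odd_family (A X :|: X)| + #|X|.
Proof.
have [f mf] := optimal_ex e X; have mf' := optimal_mate mf;
  have fK := mateK mf'.
pose I := (exposed f :\: X) :|: f @: A X.
have ID x : x \in I -> x \in Dm X /\ irregular e X f x.
  case/setUP=> [/setDP[/exposedP fx xX]|/imsetP[a aA ->]].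
    split; last by rewrite /irregular fx eqxx.
    by rewrite in_setD xX; apply/missableP; exists f.
  by rewrite (mate_A e_sym mf aA) /irregular fK (A_notin_Dm aA) orbT.
have cI : #|I| + #|X| = min_exposed X + #|A X|.
  rewrite cardsU; have -> : (exposed f :\: X) :&: f @: A X = set0.
    apply/setP=> x; rewrite !inE; apply/negP=> /andP[/andP[_ /eqP fx]].
    case/imsetP=> a aA xE; have := mate_A e_sym mf aA.
    by rewrite -xE -fx xE fK; apply/negP; apply: A_notin_Dm.
  rewrite cards0 (card_imset _ (inv_inj fK)) cardsD (setIidPr (optimal_sub mf)).
  by have := subset_leq_card (optimal_sub mf); rewrite (optimal_card mf); lia.
have inj : {in I &, injective (component (~: (A X :|: X)))}.
  move=> x z /ID[xD ix] /ID[zD iz]; rewrite !component_Dm // => E.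
  apply: (@irregular_uniq _ e e_sym X set0 f) => //; rewrite ?sub0set ?set0U //.
  by have := component_refl (Dm X) z; rewrite -E inE.
suff : component (~: (A X :|: X)) @: I \subset odd_family (A X :|: X).
  by move/subset_leq_card; rewrite card_in_imset //; lia.
apply/subsetP=> _ /imsetP[x /ID[xD _] ->]; rewrite inE; apply/andP; split.
  apply: imset_f; rewrite in_setC in_setU negb_or.
  by rewrite (contraL (@A_notin_Dm _ e X x) xD) /=; move: xD => /setDP[].
(* Oddness is read off another optimal matching g, one that exposes x: then x is the only irregular
   vertex of its component, so g preserves the component with x as single fixed point. *)
rewrite component_Dm //; move: (xD);
  rewrite inE => /andP[_ /missableP[g mg gx]].
have mg' := optimal_mate mg; pose K := component (Dm X) x.
have regK y : y \in K -> irregular e X g y -> x = y.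
  move=> yK iy; apply: (@irregular_uniq _ e e_sym X set0 g) => //.
  - exact: sub0set.
  - by rewrite set0U.
  - by rewrite inE in yK.
  - by rewrite /irregular gx eqxx.
have Kinv : invariant_set g K.
  move=> y yK; have [iy|ry] := boolP (irregular e X g y).
    by rewrite -(regK y yK iy) gx component_refl.
  exact: mate_component_Dm.
rewrite (odd_exposed (mateK mg') Kinv).
have -> : exposed g :&: K = [set x].
  apply/setP=> y; rewrite !inE; apply/andP/eqP => [[gy yK]|->].
    by apply/esym/regK; rewrite ?inE // /irregular gy.
  by rewrite gx eqxx connect0.
by rewrite cards1.
Qed.

(** The factor 2 arises because [min_exposed X] is def(G - X) + #|X|. The reverse inequality is
    [min_exposed_le2]. *)
Definition extreme X := min_exposed set0 + 2 * #|X| <= min_exposed X.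

Definition tight X := min_exposed set0 + #|X| == #|odd_family X|.

Lemma tight_extreme X : tight X -> extreme X.
Proof.
have [f mf] := optimal_ex e X;
  rewrite /extreme /tight -(optimal_card mf) => /eqP E.
by have := card_odd_family (optimal_mate mf) (optimal_sub mf); lia.
Qed.

(* The Tutte-Berge formula for G - X. *)
Lemma extreme_tight X : extreme X -> tight (A X :|: X).
Proof.
rewrite /extreme /tight => ext; have := odd_family_le (A X :|: X).
have := card_odd_family_A X; have -> : #|A X :|: X| = #|A X| + #|X|.
  rewrite cardsU; have -> : A X :&: X = set0; last by rewrite cards0 subn0.
  by apply/setP=> a; rewrite in_set0 in_setI; apply/negP=> /andP[/A_notin/negP].
by lia.
Qed.

Lemma extremeS X Y : Y \subset X -> extreme X -> extreme Y.
Proof.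
rewrite /extreme => sub ext; have [f mf] := optimal_ex e Y.
have : min_exposed X <= #|exposed (cut f X)|.
  apply: min_exposed_le; first exact: cut_mate (optimal_mate mf).
  by apply/subsetP=> x xX; rewrite mem_exposed_cut xX orbT.
have := card_exposed_cut X (mateK (optimal_mate mf)); rewrite (optimal_card mf).
have := subset_leq_card (setDS X (optimal_sub mf));
  rewrite (cardsD X Y) (setIidPr sub).
by have := subset_leq_card sub; lia.
Qed.

(** * Smiling vertices and extreme sets *)

Local Notation smiles u v := (v \in Dm [set u]).

(** A description symmetric in u and v; the bound def G + 2 is the value of [min_exposed
    [set u]]. *)
Lemma smileP u v : u \notin D set0 ->
  reflect (v != u /\ exists f, [/\ mate f, f u = u, f v = v
             & #|exposed f| <= min_exposed set0 + 2]) (smiles u v).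
Proof.
move=> /min_exposedU1; rewrite setU0 => mE.
rewrite in_setD in_set1; apply: (iffP andP) => -[vu].
  move=> /missableP[f mf fv]; split=> //; exists f; split=> //.
  - exact: optimal_mate mf.
  - by apply: optimal_fix mf _; rewrite set11.
  - by rewrite (optimal_card mf) mE.
case=> f [mf fu fv le]; split=> //; apply: D_mate mf _ _ fv.
  by apply/subsetP=> x /set1P->; rewrite inE fu.
by rewrite mE.
Qed.

Lemma smiles_sym u v : u \notin D set0 -> v \notin D set0 ->
  smiles u v = smiles v u.
Proof.
move=> uD vD; apply/(smileP _ uD)/(smileP _ vD) => -[neq [f [mf fu fv le]]];
  by split; rewrite 1?eq_sym //; exists f; split.
Qed.

Lemma extreme_smileP X :
  extreme X <-> (forall u, u \in X -> u \notin D set0) /\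
                (forall u v, u \in X -> v \in X -> ~~ smiles u v).
Proof.
split=> [ext|[XD]].
  have XD u : u \in X -> u \notin D set0.
    move=> uX; have : extreme [set u] by apply: extremeS ext; rewrite sub1set.
    rewrite /extreme cards1; apply: contraL => /missableP[f mf fu];
      rewrite -ltnNge.
    have : min_exposed [set u] <= #|exposed f|.
      apply: min_exposed_le (optimal_mate mf) _.
      by apply/subsetP=> x /set1P->; rewrite inE fu.
    by rewrite (optimal_card mf); lia.
  split=> // u v uX vX; apply/(smileP _ (XD u uX)) => -[vu [f [mf fu fv le]]].
  have : extreme [set u; v].
    by apply: extremeS ext; apply/subsetP=> x /set2P[]->.
  rewrite /extreme cards2 eq_sym vu /=.
  suff : min_exposed [set u; v] <= #|exposed f| by lia.
  by apply: min_exposed_le mf _; apply/subsetP=> x /set2P[]->;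
    rewrite inE ?fu ?fv.
have [k] := ubnP #|X|; elim: k X XD => // k IHk X XD ltX Xfree.
have [->|[x xX]] := set_0Vmem X; first by rewrite /extreme cards0 addn0.
have cX := cardsD1 x X; rewrite xX in cX.
have : extreme (X :\ x).
  apply: IHk; [|lia|] => [u /setD1P[_ uX]|u v /setD1P[_ uX] /setD1P[_ vX]].
    exact: XD.
  exact: Xfree.
have [f mf] := optimal_ex e set0; have [g mg] := optimal_ex e X.
have [mf' mg'] := (optimal_mate mf, optimal_mate mg).
have [K [xK fI gI _ ends]] :=
  orbit_endsP (mateK mf') (mateK mg') (optimal_fix mg xX).
(* If the path from x ends in a vertex exposed by f, exchanging f shows that x is missable.
   Otherwise g exposes both ends x and y: if y is in X, exchanging f shows that they smile; if not,
   exchanging g saves two exposed vertices while keeping X minus x exposed, and induction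
   applies. *)
case: ends => [y yK fE gE|y yK yx fE gE].
  case/negP: (XD x xX); apply: (@D_mate _ e _ (swap f g K)).
  - exact: swap_mate.
  - exact: sub0set.
  - by have := card_exposed_swap f g K;
      rewrite fE gE !cards1 (optimal_card mf); lia.
  - by rewrite ffunE xK (optimal_fix mg xX).
have gy : g y = y.
  by apply/exposedP; have /setIP[] : y \in exposed g :&: K by rewrite gE set22.
have yX : y \notin X.
  apply/negP=> yX; case/negP: (Xfree x y xX yX); apply/(smileP _ (XD x xX)).
  split=> //; exists (swap f g K); split; first exact: swap_mate.
  - by rewrite ffunE xK (optimal_fix mg xX).
  - by rewrite ffunE yK.
  have := card_exposed_swap f g K; rewrite fE gE cards0 cards2 eq_sym yx.
  by rewrite (optimal_card mf) /=; lia.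
have : min_exposed (X :\ x) <= #|exposed (swap g f K)|.
  apply: min_exposed_le; first exact: swap_mate.
  apply/subsetP=> z /setD1P[zx zX]; rewrite inE ffunE; case: ifP => zK;
    last first.
    by rewrite (optimal_fix mg zX).
  have : z \in exposed g :&: K by rewrite !inE (optimal_fix mg zX) eqxx.
  by rewrite gE !inE (negbTE zx) => /eqP zy; rewrite -zy zX in yX.
have := card_exposed_swap g f K; rewrite fE gE cards0 cards2 eq_sym yx.
by rewrite (optimal_card mg) /extreme /=; lia.
Qed.

Lemma maxset_tightP X :
  maxset tight X <->
  [/\ forall u, u \in X -> u \notin D set0,
      forall u v, u \in X -> v \in X -> ~~ smiles u v
    & forall v, v \notin X -> v \notin D set0 -> exists2 u,
      u \in X & smiles v u].
Proof.
split=> [/maxsetP[tX maxX]|[XD Xfree Xmax]].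
  have [XD Xfree] := (extreme_smileP X).1 (tight_extreme tX).
  split=> // v vX vD; apply/exists_inP/contraT.
  rewrite negb_exists => /forallP nsm.
  have ext : extreme (v |: X).
    apply/extreme_smileP; split=> [u /setU1P[->//|]|u w]; first exact: XD.
    have vw z : z \in X -> ~~ smiles v z by move=> zX; have := nsm z;
      rewrite zX.
    case/setU1P=> [->|uX] /setU1P[->|wX].
    - by rewrite in_setD set11.
    - exact: vw.
    - by rewrite smiles_sym; [exact: vw | exact: XD |].
    - exact: Xfree.
  (* The barrier generated by [v |: X] contains X, so maximality puts v into X. *)
  have := maxX _ (extreme_tight ext).
  have sub : X \subset A (v |: X) :|: (v |: X) 
    by rewrite setUCA subsetU // subsetU ?subxx ?orbT.
  move/(_ sub)=> E; case/negP: vX; rewrite -E.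
  by rewrite in_setU setU11 orbT.
have key Y : tight Y -> X \subset Y -> Y = X.
  move=> /tight_extreme/extreme_smileP[YD Yfree] /subsetP XY.
  apply/setP=> v; apply/idP/idP => [vY|/XY//]; apply: contraT => vX.
  have [u /XY uY] := Xmax v vX (YD v vY).
  by rewrite (negbTE (Yfree v u vY uY)).
apply/maxsetP; split; last by move=> Y tY XY; apply: key.
have tX : tight (A X :|: X) by apply/extreme_tight/extreme_smileP.
by rewrite -(key _ tX) // subsetUr.
Qed.

End Barriers.

(** * Matchings, barriers and components of a graph in terms of involutions *)

Section MatchingMate.
Variable G : graph.
Implicit Types (x y : G) (M : {set {set G}}) (f : {ffun G -> G}).

Lemma edgeP (E : {set G}) :
  reflect (exists x y, [/\ adj x y, x != y & E = [set x; y]]) (E \in edges G).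
Proof.
rewrite inE; apply: (iffP existsP) => [[x /existsP[y /and3P[xy neq /eqP ->]]]|].
  by exists x, y.
by case=> x [y [xy neq ->]]; exists x; apply/existsP; exists y;
  rewrite xy neq /=.
Qed.

Lemma matching_cover_card M : matching M -> #|cover M| = 2 * #|M|.
Proof.
case/andP=> /subsetP Medge /eqP <-; rewrite mulnC -sum_nat_const.
by apply: eq_bigr => E /Medge/edgeP[x [y [_ neq ->]]]; rewrite cards2 neq.
Qed.

(** The last clause requires x != y because f x = x encodes an exposed vertex and not an edge. *)
Definition mate_of M f :=
  [/\ mate (@adj G) f, exposed f = ~: cover M
    & forall x y, x != y -> ([set x; y] \in M) = (f x == y)].

Lemma matching_mate M : matching M -> exists f, mate_of M f.
Proof.
move=> /andP[/subsetP Medge /trivIsetP triv].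
have uniqM x y z : [set x; y] \in M -> [set x; z] \in M -> x != y -> y = z.
  move=> xyM xzM xy; have [E|/(triv _ _ xyM xzM)] := eqVneq [set x; y] [set x;
    z].
    have : y \in [set x; z] by rewrite -E set22.
    by case/set2P=> // yx; rewrite yx eqxx in xy.
  by rewrite disjoint_subset => /subsetP/(_ x (set21 x y)); rewrite inE set21.
(* The default x makes uncovered vertices fixed points. *)
pose f := [ffun x => odflt x [pick y | (x != y) && ([set x; y] \in M)]].
have fP x y : x != y -> ([set x; y] \in M) = (f x == y).
  move=> xy; rewrite ffunE; case: pickP => [z /andP[xz xzM]|noy] /=.
    apply/idP/eqP => [xyM|<-//]; exact: (uniqM x z y).
  by have := noy y; rewrite xy /= => ->; rewrite (negbTE xy).
have fM x : f x != x -> [set x; f x] \in M by move=> fx; rewrite fP // eq_sym.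
exists f; split=> //.
  apply/mateP; split=> [x|x fx].
    have [fx|fx] := eqVneq (f x) x; first by rewrite !fx.
    by apply/eqP; rewrite -fP // setUC fM.
  have /edgeP[u [v [uv neq E]]] := Medge _ (fM x fx).
  have : x \in [set u; v] by rewrite -E set21.
  have : f x \in [set u; v] by rewrite -E set22.
  case/set2P=> fE /set2P[] xE; rewrite ?fE xE //.
  - by rewrite fE xE eqxx in fx.
  - by rewrite adj_sym.
  - by rewrite fE xE eqxx in fx.
apply/setP=> x; rewrite !inE; apply/eqP/idP => [fx|]; last first.
  apply: contraNeq => /fM xM; apply/bigcupP; exists [set x; f x] => //.
  exact: set21.
apply/negP=> /bigcupP[E EM]; have /edgeP[u [v [_ neq EE]]] := Medge E EM.
have fu : f u = v by apply/eqP; rewrite -fP // -EE.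
have fv : f v = u by apply/eqP; rewrite -fP 1?eq_sym // setUC -EE.
by rewrite EE => /set2P[] xE; move: fx neq; rewrite xE ?fu ?fv => ->;
  rewrite eqxx.
Qed.

Lemma mate_matching f : mate (@adj G) f -> exists2 M, matching M & mate_of M f.
Proof.
move=> mf; have fK := mateK mf.
pose M := [set [set x; f x] | x in ~: exposed f].
have fP x y : x != y -> ([set x; y] \in M) = (f x == y).
  move=> xy; apply/imsetP/eqP => [[z]|fx].
    rewrite !inE => fz E.
    have : x \in [set z; f z] by rewrite -E set21.
    have : y \in [set z; f z] by rewrite -E set22.
    by case/set2P=> yE /set2P[] xE; subst x y; rewrite ?fK // eqxx in xy *.
  by exists x; rewrite ?fx // !inE fx eq_sym.
exists M; last first.
  split=> //; apply/setP=> x; rewrite inE in_setC.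
  apply/eqP/idP => [fx|]; last first.
    apply: contraNeq => fx; apply/bigcupP; exists [set x; f x];
      last exact: set21.
    by apply/imsetP; exists x => //; rewrite !inE.
  apply/negP=> /bigcupP[_ /imsetP[z zE ->]]; rewrite !inE in zE.
  case/set2P=> E; rewrite E ?fK in fx; first by rewrite fx eqxx in zE.
  by rewrite -fx eqxx in zE.
apply/andP; split.
  apply/subsetP=> _ /imsetP[x xE ->]; have fx : f x != x by rewrite !inE in xE.
  by apply/edgeP; exists x, (f x); rewrite mate_adj // eq_sym.
apply/trivIsetP=> _ _ /imsetP[x xE ->] /imsetP[y yE ->].
apply: contraR => /pred0Pn[z /= /andP[]].
case/set2P=> -> /set2P[] E.
- by rewrite E.
- by rewrite E fK setUC.
- by rewrite -E fK setUC.
- by rewrite (inv_inj fK E).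
Qed.

Lemma card_mate_of M f : matching M -> mate_of M f ->
  #|exposed f| + 2 * #|M| = #|G|.
Proof.
by move=> mM [_ -> _]; rewrite -matching_cover_card // addnC cardsC.
Qed.

Lemma card_matching_le M : matching M -> #|M| <= nu G.
Proof. by move=> mM; apply: leq_bigmax_cond. Qed.

Lemma matching_set0 : matching (set0 : {set {set G}}).
Proof. by rewrite /matching sub0set; apply/trivIsetP=> ? ?; rewrite inE. Qed.

Lemma nu_matching : exists2 M : {set {set G}}, matching M & #|M| = nu G.
Proof.
by have [|M mM ME] := @eq_bigmax_cond _ (@matching G) (fun M => #|M|);
  [apply/card_gt0P; exists set0; apply: matching_set0 | exists M].
Qed.

Lemma min_exposed_nu : min_exposed (@adj G) set0 + 2 * nu G = #|G|.
Proof.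
have [M mM ME] := nu_matching; have [f fM] := matching_mate mM.
have cf := card_mate_of mM fM; have [mf _ _] := fM.
have [g mg] := optimal_ex (@adj G) set0.
have [N mN gN] := mate_matching (optimal_mate mg).
have := card_mate_of mN gN; rewrite (optimal_card mg).
have := card_matching_le mN; have := min_exposed_le mf (sub0set _); lia.
Qed.

Lemma deficiencyE : deficiency G = min_exposed (@adj G) set0.
Proof. by rewrite /deficiency -min_exposed_nu addnK. Qed.

Lemma maximum_mate_of M f : mate_of M f ->
  matching M -> maximum_matching M = optimal (@adj G) set0 f.
Proof.
move=> fM mM; have := card_mate_of mM fM; have [mf _ _] := fM.
have := min_exposed_le mf (sub0set _); have := min_exposed_nu.
rewrite /maximum_matching /optimal mM mf sub0set /=; move: #|M| #|exposed f|.
by move=> m n E1 E2 E3; apply/idP/idP; lia.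
Qed.

Lemma exposableE : exposable G = missable (@adj G) set0.
Proof.
apply/setP=> x; apply/idP/missableP => [|[f mf fx]].
  rewrite inE => /existsP[M /andP[maxM xM]]; have /andP[mM _] := maxM.
  have [f fM] := matching_mate mM; have [_ fE _] := fM.
  exists f; first by rewrite -(maximum_mate_of fM mM).
  by apply/exposedP; rewrite fE inE.
have [M mM fM] := mate_matching (optimal_mate mf); have [_ fE _] := fM.
rewrite inE; apply/existsP; exists M; rewrite (maximum_mate_of fM mM) mf /=.
by rewrite -in_setC -fE inE fx.
Qed.

Lemma exposable_nbrsE : exposable_nbrs G = missable_nbrs (@adj G) set0.
Proof.
rewrite /exposable_nbrs exposableE; apply/setP=> a; rewrite inE in_setC.
apply/andP/missable_nbrsP => -[aD].
  by case/exists_inP=> y yD ya; split=> //; exists y;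
    rewrite // /missable_rest setD0.
case=> y yD ya; split=> //; apply/exists_inP; exists y => //.
by rewrite /missable_rest setD0 in yD.
Qed.

Lemma allowedP x y :
  reflect (x != y /\ exists2 f, optimal (@adj G) set0 f & f x = y)
    (allowed x y).
Proof.
apply: (iffP existsP) => [[M /andP[maxM xyM]]|[xy [f mf fx]]].
  have /andP[mM _] := maxM; have [f fM] := matching_mate mM.
  have neq : x != y.
    have /andP[/subsetP/(_ _ xyM)/edgeP[u [v [_ uv E]]] _] := mM.
    have : #|[set x; y]| = #|[set u; v]| by rewrite E.
    by rewrite !cards2 uv; case: (x != y).
  split=> //; have [_ _ fP] := fM; exists f; last by apply/eqP; rewrite -fP.
  by rewrite -(maximum_mate_of fM mM).
have [M mM fM] := mate_matching (optimal_mate mf); have [_ _ fP] := fM.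
by exists M; rewrite (maximum_mate_of fM mM) mf fP // fx /=.
Qed.

Lemma has_perfect_matchingP :
  reflect (exists2 f, mate (@adj G) f & exposed f = set0)
    (has_perfect_matching G).
Proof.
apply: (iffP existsP) => [[M /andP[mM /eqP cM]]|[f mf fE]].
  have [f fM] := matching_mate mM; have [mf fE _] := fM.
  by exists f => //; rewrite fE cM setCT.
have [M mM [_ fM _]] := mate_matching mf; exists M; rewrite mM /=.
by rewrite -[cover M]setCK -fM fE setC0.
Qed.

End MatchingMate.

(** * Matchings and components of induced subgraphs *)

Section Induced.
Variables (G : graph) (Y : {set G}).

Lemma mate_lift (f : {ffun induced Y -> induced Y}) :
  mate (@adj (induced Y)) f -> exists g : {ffun G -> G},
    [/\ mate (@adj G) g, forall u, g (val u) = val (f u)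
      & forall x, x \notin Y -> g x = x].
Proof.
move=> mf.
pose g : {ffun G -> G} := [ffun x : G =>
  if insub x is Some u then val (f u) else x].
have gval (u : induced Y) : g (val u) = val (f u) by rewrite ffunE valK.
have gout x : x \notin Y -> g x = x by move=> xY; rewrite ffunE insubN.
exists g; split=> //; apply/mateP; split=> [x|x].
  have [xY|xY] := boolP (x \in Y); last by rewrite !gout.
  by rewrite -[x]/(val (Sub x xY : induced Y)) !gval (mateK mf).
have [xY|/gout->] := boolP (x \in Y); last by rewrite eqxx.
rewrite -[x]/(val (Sub x xY : induced Y)) gval => neq.
by apply: (mate_adj mf); apply: contra neq => /eqP->.
Qed.

Lemma mate_restrict (g : {ffun G -> G}) :
  mate (@adj G) g -> ~: Y \subset exposed g ->
  exists f : {ffun induced Y -> induced Y},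
    mate (@adj (induced Y)) f /\ forall u, val (f u) = g (val u).
Proof.
move=> mg /subsetP gout; pose f : {ffun induced Y -> induced Y} :=
  [ffun u : induced Y => insubd u (g (val u))].
(* Hence the default value of [insubd] is never taken. *)
have gY x : x \in Y -> g x \in Y.
  move=> xY; apply: contraT => gxY;
    have /gout/exposedP : g x \in ~: Y by rewrite inE.
  by rewrite (mateK mg) => E; rewrite -E xY in gxY.
have fval u : val (f u) = g (val u) by rewrite ffunE val_insubd gY ?(valP u).
exists f; split=> //; apply/mateP; split=> [u|u fu].
  by apply: val_inj; rewrite !fval (mateK mg).
by rewrite [adj _ _]/(adj (val u) (val (f u))) fval mate_adj // -fval.
Qed.

Lemma exposed_lift (f : {ffun induced Y -> induced Y}) (g : {ffun G -> G}) :
  (forall u, g (val u) = val (f u)) -> (forall x, x \notin Y -> g x = x) ->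
  exposed g = ~: Y :|: val @: exposed f.
Proof.
move=> gval gout; apply/setP=> x; rewrite in_setU in_setC.
have [xY|xY] /= := boolP (x \in Y); last by rewrite inE gout // eqxx.
have -> : x = val (Sub x xY : induced Y) by [].
by rewrite (mem_imset _ _ val_inj) !inE gval.
Qed.

Lemma card_exposed_lift (f : {ffun induced Y -> induced Y}) (g : {ffun G -> G})
  :
  (forall u, g (val u) = val (f u)) -> (forall x, x \notin Y -> g x = x) ->
  #|exposed g| = #|~: Y| + #|exposed f|.
Proof.
move=> gval gout; rewrite (exposed_lift gval gout) cardsU.
have -> : ~: Y :&: val @: exposed f = set0.
  apply/setP=> x; rewrite !inE; apply/negP=> /andP[xY /imsetP[u _ xE]].
  by rewrite xE (valP u) in xY.
by rewrite cards0 subn0 (card_imset _ val_inj).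
Qed.

Lemma min_exposed_induced :
  min_exposed (@adj (induced Y)) set0 + #|~: Y| = min_exposed (@adj G) (~: Y).
Proof.
have [f mf] := optimal_ex (@adj (induced Y)) set0.
have [g [mg gval gout]] := mate_lift (optimal_mate mf).
have cg := card_exposed_lift gval gout.
have [g' mg'] := optimal_ex (@adj G) (~: Y).
have [f' [mf' fval']] := mate_restrict (optimal_mate mg') (optimal_sub mg').
have gout' x : x \notin Y -> g' x = x.
  by move=> xY; apply: optimal_fix mg' _; rewrite inE.
have cg' := card_exposed_lift (fun u => esym (fval' u)) gout'.
have := min_exposed_le mf' (sub0set _).
have : min_exposed (@adj G) (~: Y) <= #|exposed g|.
  by apply: min_exposed_le mg _; apply/subsetP=> x; rewrite !inE => /gout->.
by move: cg cg'; rewrite (optimal_card mf) (optimal_card mg'); lia.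
Qed.

Lemma connect_induced (x y : induced Y) :
  connect (@adj (induced Y)) x y = connect (rel_in (@adj G) Y) (val x) (val y).
Proof.
apply/idP/idP.
  case/connectP=> p; elim: p x => [|z p IHp] x /=; first by move=> _ ->.
  case/andP=> xz zp yE; apply: connect_trans (IHp z zp yE); apply: connect1.
  by rewrite /rel_in !(valP x, valP z).
case/connectP=> p; elim: p x => [|z p IHp] x /=.
  by move=> _ /val_inj ->.
case/andP=> /and3P[xY zY xz] zp yE.
have /(connect_trans _) := IHp (Sub z zY) zp yE; apply.
exact: connect1.
Qed.

Lemma components_inE : components_in Y = component_family (@adj G) Y.
Proof.
have classE (x : induced Y) :
    [set val y | y in [set y in [set: induced Y] | connect (@adj (induced Y)) x
      y]]
    = component (@adj G) Y (val x).
  apply/setP=> z; rewrite inE; apply/imsetP/idP => [[y yx ->]|xz].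
    by move: yx; rewrite !inE -connect_induced.
  have zY : z \in Y by apply: (subsetP (@component_sub _ (@adj G) _ _ (valP
    x))); rewrite inE.
  by exists (Sub z zY) => //; rewrite !inE connect_induced.
apply/setP=> K; apply/imsetP/imsetP => [[C /imsetP[x _ ->] ->]|[x xY ->]].
  by exists (val x); [exact: valP | exact: classE].
exists [set y in [set: induced Y] | connect (@adj (induced Y)) (Sub x xY) y].
  by apply/imsetP; exists (Sub x xY).
by rewrite classE.
Qed.

End Induced.

(** * Deficiency, barriers and perfect matchings after deleting vertices *)

Section Transfer.
Variable G : graph.
Implicit Types X Y Z H : {set G}.

Lemma deficiency_delete Z : deficiency (delete Z) + #|Z| = min_exposed (@adj G)
  Z.
Proof. by rewrite deficiencyE; have := min_exposed_induced (~: Z);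
  rewrite setCK. Qed.

Lemma odd_componentsE Y : odd_components Y = #|odd_family (@adj G) Y|.
Proof.
rewrite /odd_family -components_inE /odd_components.
rewrite -(card_imset _ (imset_inj val_inj)).
apply: eq_card => K; rewrite inE; apply/imsetP/andP => [[C]|[/imsetP[C CC ->]]].
  rewrite inE => /andP[CC oC] ->; split; last by rewrite card_imset //;
    apply: val_inj.
  exact: imset_f.
by rewrite card_imset; [exists C; rewrite ?inE ?CC | exact: val_inj].
Qed.

Lemma maximal_barrierE X : maximal_barrier X = maxset (tight (@adj G)) X.
Proof.
apply: maxset_eq => Y; rewrite /barrier /tight deficiencyE odd_componentsE //.
Qed.

Lemma perfect_deleteP Z :
  reflect (exists2 g, mate (@adj G) g & exposed g = Z)
    (has_perfect_matching (delete Z)).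
Proof.
apply: (iffP (has_perfect_matchingP _)) => [[f mf fE]|[g mg gE]].
  have [g [mg gval gout]] := mate_lift mf; exists g => //.
  by rewrite (exposed_lift gval gout) fE imset0 setU0 setCK.
have gZ x : x \notin Z -> g x != x by rewrite -gE inE.
have [|f [mf fval]] := @mate_restrict _ (~: Z) g mg; first by rewrite setCK gE.
exists f => //; apply/setP=> u; rewrite !inE -(inj_eq val_inj) fval.
by apply/negbTE/gZ; have := valP u; rewrite inE.
Qed.

End Transfer.

(** * Factor-critical contractions *)

Section Contraction.
Variables (G : graph) (X H : {set G}).

Let Y := X :\: H.
Let H' := [set x : induced X | val x \in H].
Let V := {x : induced X | x \notin H'}.
Let vl (u : V) : G := val (val u).
Let ins (x : G) : option V := [pick u | vl u == x].

Let vl_inj : injective vl.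
Proof. by move=> u v /val_inj/val_inj. Qed.

Let vlY u : vl u \in Y.
Proof. by rewrite inE (valP (val u)) andbT; have := valP u; rewrite inE. Qed.

Let insK u : ins (vl u) = Some u.
Proof.
rewrite /ins; case: pickP => [v /eqP/vl_inj->//|/(_ u)]; by rewrite eqxx.
Qed.

Let vl_surj x : x \in Y -> exists u, vl u = x.
Proof.
case/setDP=> xX xH.
have xP : (Sub x xX : induced X) \notin H' by rewrite inE.
by exists (Sub (Sub x xX : induced X) xP).
Qed.

Let mate_expand (f : {ffun contract H' -> contract H'}) :
  mate (@adj (contract H')) f ->
  exists g : {ffun G -> G}, [/\ mate (@adj G) g, forall x, x \notin Y -> g x = x
    & forall u, g (vl u) = if f (Some u) is Some v then vl v else vl u].
Proof.
move=> mf; have fK := mateK mf.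
pose g : {ffun G -> G} := [ffun x => if ins x is Some u then
  (if f (Some u) is Some v then vl v else vl u) else x].
have gout x : x \notin Y -> g x = x.
  by rewrite ffunE /ins; case: pickP => // u /eqP<-; rewrite vlY.
have gvl u : g (vl u) = if f (Some u) is Some v then vl v else vl u.
  by rewrite ffunE insK.
exists g; split=> //; apply/mateP; split=> x.
  have [/vl_surj[u <-]|xY] := boolP (x \in Y); last by rewrite !gout.
  rewrite gvl; case E : (f (Some u)) => [v|]; last by rewrite gvl E.
  by rewrite gvl -E fK.
have [/vl_surj[u <-]|xY] := boolP (x \in Y); last by rewrite gout ?eqxx.
rewrite gvl; case E : (f (Some u)) => [v|]; last by rewrite eqxx.
move=> neq; have := @mate_adj _ _ _ (Some u) mf; rewrite E; apply.
by apply: contra neq => /eqP[->].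
Qed.

(** Here [o] is the prescribed mate of the contracted vertex [None]; taking [o = None] leaves that
    vertex exposed. *)
Let mate_collapse (g : {ffun G -> G}) (o : option V) :
  mate (@adj G) g -> ~: Y \subset exposed g ->
  (forall u, o = Some u -> g (vl u) = vl u /\ exists2 h,
    h \in H & adj h (vl u)) ->
  H \subset X ->
  exists f : {ffun contract H' -> contract H'},
    [/\ mate (@adj (contract H')) f, f None = o
      & forall u, Some u != o -> exists2 v,
        f (Some u) = Some v & vl v = g (vl u)].
Proof.
move=> mg /subsetP gout oP HX; have gK := mateK mg.
have gY x : x \in Y -> g x \in Y.
  move=> xY; apply: contraT => gxY;
    have /gout/exposedP : g x \in ~: Y by rewrite inE.
  by rewrite gK => E; rewrite -E xY in gxY.
pose f : {ffun contract H' -> contract H'} := [ffun a : option V =>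
  if a is Some u then (if Some u == o then None else ins (g (vl u))) else o].
have fS u : Some u != o -> exists2 v, f (Some u) = Some v & vl v = g (vl u).
  move=> uo; have [v vE] := vl_surj (gY _ (vlY u)); exists v => //.
  by rewrite ffunE (negbTE uo) -vE insK.
have fN : f None = o by rewrite ffunE.
exists f; split=> //.
have fo u : Some u = o -> f (Some u) = None by move=> uo; rewrite ffunE uo eqxx.
have aN (u : V) : o = Some u -> @adj (contract H') None (Some u).
  move=> uo; have [_ [h hH hu]] := oP u uo.
  by apply/exists_inP; exists (Sub h (subsetP HX h hH) : induced X);
    rewrite ?inE.
apply/mateP; split=> -[u|].
- have [uo|/eqP uo] := Some u =P o; first by rewrite (fo u uo) fN.
  have [v fu vE] := fS u uo; rewrite fu.
  have vo : Some v != o.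
    apply: contra uo => /eqP/esym vo; have [gv _] := oP v vo.
    by rewrite vo; apply/eqP; congr Some; apply: vl_inj;
      rewrite -(gK (vl u)) -vE gv.
  by have [w -> wE] := fS v vo; congr Some; apply: vl_inj; rewrite wE vE gK.
- by rewrite fN; case E : o => [u|]; [apply: fo|rewrite fN E].
- have [uo|/eqP uo] := Some u =P o.
    by rewrite (fo u uo) => _; rewrite adj_sym; apply: aN.
  have [v -> vE] := fS u uo => neq.
  suff : adj (vl u) (vl v) by [].
  rewrite vE mate_adj // -vE; apply: contra neq => /eqP vu.
  by rewrite (vl_inj vu).
by rewrite fN; case E : o => [u|] //= _; apply: aN.
Qed.

(** A matching of the contraction is read in G by dropping the edge at the contracted vertex. When w
    is deleted, that edge survives as an exposed vertex r together with a neighbour h of r in H. *)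
Lemma contract_criticalP : H \subset X ->
  reflect
    ((exists2 g, mate (@adj G) g & exposed g = ~: (X :\: H)) /\
     forall w, w \in X :\: H -> exists g r h,
       [/\ mate (@adj G) g, r \in X :\: H, h \in H, adj h r
         & r != w /\ exposed g = w |: (r |: ~: (X :\: H))])
    (factor_critical (contract [set x : induced X | val x \in H])).
Proof.
move=> HX; rewrite -/Y -/H'; apply: (iffP forallP) => [crit|[[g mg gE] crit] a].
  split.
    have /perfect_deleteP[f mf fE] := crit None.
    have [g [mg gout gvl]] := mate_expand mf; exists g => //.
    apply/setP=> x; rewrite in_setC; apply/exposedP/idP => [gx|/gout//].
    apply/negP=> /vl_surj[u uE]; rewrite -uE gvl in gx.
    have fN : f None = None by apply/exposedP; rewrite fE set11.
    case E : (f (Some u)) gx => [v|] vu; last first.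
      by have := mateK mf (Some u); rewrite E fN.
    have : Some u \in exposed f by rewrite inE E (vl_inj vu).
    by rewrite fE inE.
  move=> _ /vl_surj[u <-]; have /perfect_deleteP[f mf fE] := crit (Some u).
  have [g [mg gout gvl]] := mate_expand mf.
  case fN : (f None) => [v|]; last first.
    have : None \in exposed f by rewrite inE fN.
    by rewrite fE inE.
  have : @adj (contract H') None (Some v).
    by rewrite -fN mate_adj // fN.
  case/exists_inP=> z; rewrite inE => zH zv.
  have fv : f (Some v) = None by rewrite -fN (mateK mf).
  exists g, (vl v), (val z); split=> //; split.
    apply: contraTneq isT => /vl_inj vu; rewrite vu in fv.
    have : Some u \in exposed f by rewrite fE set11.
    by move/exposedP; rewrite fv.
  apply/setP=> x; rewrite in_setU1 in_setU1 in_setC.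
  apply/exposedP/or3P => [gx|]; last first.
    case=> [/eqP->|/eqP->|/gout//]; rewrite gvl; last by rewrite fv.
    by have /exposedP-> : Some u \in exposed f by rewrite fE set11.
  have [xY|xY] := boolP (x \in Y); last by apply: Or33.
  have [w wE] := vl_surj xY; rewrite -wE gvl in gx *.
  case E : (f (Some w)) gx => [w'|] ww; last first.
    have wv : Some w = Some v by rewrite -fN -E (mateK mf).
    by case: wv => ->; apply: Or32.
  have : Some w \in exposed f by rewrite inE E (vl_inj ww).
  by rewrite fE => /set1P[->]; apply: Or31.
apply/perfect_deleteP; case: a => [w|].
  have [g1 [r [h [mg1 rY hH hr [rw g1E]]]]] := crit _ (vlY w).
  have [ur urE] := vl_surj rY; subst r.
  have [|||f [mf fN fS]] := @mate_collapse g1 (Some ur) mg1.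
  - by rewrite g1E; apply/subsetP=> x xY; rewrite !in_setU xY !orbT.
  - move=> _ [<-]; split; last by exists h.
    by apply/exposedP; rewrite g1E in_setU1 setU11 orbT.
  - by [].
  exists f => //; apply/setP=> -[u|]; rewrite [LHS]inE [RHS]inE;
    last by rewrite fN.
  have [[->]|/eqP ur_u] := Some u =P Some ur.
    have -> : f (Some ur) = None by rewrite -fN (mateK mf).
    by apply/esym/eqP=> -[uw]; rewrite uw eqxx in rw.
  have [v -> vE] := fS u ur_u; apply/eqP/eqP => [[vu]|[uw]].
    have : vl u \in exposed g1 by rewrite inE -vE vu.
    rewrite g1E 2!in_setU1 in_setC vlY orbF =>
      /orP[/eqP/vl_inj->//|/eqP/vl_inj E].
    by rewrite E eqxx in ur_u.
  congr Some; apply: vl_inj; rewrite vE uw.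
  by apply/exposedP; rewrite g1E setU11.
have [|||f [mf fN fS]] := @mate_collapse g None mg.
- by rewrite gE.
- by [].
- by [].
exists f => //; apply/setP=> -[u|]; rewrite [LHS]inE [RHS]inE;
  last by rewrite fN.
have [//|v -> vE] := fS u; apply: negbTE; apply/eqP=> -[vu].
have : vl u \in exposed g by rewrite inE -vE vu.
by rewrite gE in_setC vlY.
Qed.

End Contraction.

(** * Factor-components *)

Section FactorComponents.
Variable G : graph.
Implicit Types (x y u v w z : G) (H S W X Z : {set G}) (f : {ffun G -> G}).

Local Notation e := (@adj G).
Local Notation max0 := (optimal e set0).
Local Notation D0 := (missable e set0).
Local Notation A0 := (missable_nbrs e set0).
Local Notation Du u := (missable_rest e [set u]).
Local Notation Au u := (missable_nbrs e [set u]).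
Local Notation Q u := (component e (Du u)).
Local Notation adjS := (@adj_sym G).

Lemma allowed_sym : symmetric (@allowed G).
Proof. by move=> x y; rewrite /allowed setUC. Qed.

Lemma allowed_adj x y : allowed x y -> adj x y.
Proof.
case/allowedP=> neq [f mf fx]; rewrite -fx; apply: mate_adj (optimal_mate mf) _.
by rewrite fx eq_sym.
Qed.

Definition fcomp x := [set y | factor_connected x y].

Lemma factor_componentsE : factor_components G = [set fcomp x | x : G].
Proof.
apply/setP=> K; apply/imsetP/imsetP => -[x _ ->]; exists x; rewrite ?inE //;
  by apply/setP=> y; rewrite !inE.
Qed.

Lemma fcomp_refl x : x \in fcomp x.
Proof. by rewrite inE; apply: connect0. Qed.

Lemma fcomp_component x : fcomp x \in factor_components G.
Proof. by rewrite factor_componentsE imset_f. Qed.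

Lemma fcomp_eq H x : H \in factor_components G -> x \in H -> H = fcomp x.
Proof.
rewrite factor_componentsE => /imsetP[y _ ->]; rewrite inE => yx.
apply/setP=> z; rewrite !inE.
exact: (same_connect (sym_connect_sym allowed_sym) yx).
Qed.

Lemma fcomp_mate x f : max0 f -> f x \in fcomp x.
Proof.
move=> mf; have [->|fx] := eqVneq (f x) x; first exact: fcomp_refl.
by rewrite inE; apply/connect1/allowedP; split; [rewrite eq_sym | exists f].
Qed.

Lemma component_mate H f : H \in factor_components G -> max0 f ->
  invariant_set f H.
Proof. by move=> HH mf x xH; rewrite (fcomp_eq HH xH) fcomp_mate. Qed.

(** Factor-connectedness is exploited through this closure principle: an allowed edge is a move of
    some maximum matching. *)
Lemma fcomp_min Z x : (forall f, max0 f -> invariant_set f Z) ->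
  x \in Z -> fcomp x \subset Z.
Proof.
move=> ZI xZ; apply/subsetP=> y; rewrite inE => /connectP[p].
elim: p x xZ => [|z p IHp] x xZ /=; first by move=> _ ->.
by case/andP=> /allowedP[_ [f mf <-]]; apply: IHp; apply: ZI.
Qed.

Lemma separatingP X :
  reflect (forall f, max0 f -> invariant_set f X) (separating X).
Proof.
apply: (iffP existsP) => [[P /andP[/subsetP PF /eqP->]] f mf x|XI].
  case/bigcupP=> H HP xH; apply/bigcupP; exists H => //.
  exact: component_mate (PF H HP) mf x xH.
exists [set fcomp x | x in X]; apply/andP; split.
  by apply/subsetP=> _ /imsetP[x _ ->]; apply: fcomp_component.
rewrite eqEsubset; apply/andP; split; apply/subsetP=> x.
  by move=> xX; apply/bigcupP; exists (fcomp x); rewrite ?imset_f ?fcomp_refl.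
by case/bigcupP=> _ /imsetP[y yX ->]; apply/subsetP/fcomp_min.
Qed.

Lemma D0_smiles u v : u \notin D0 -> v \in D0 -> v \in Du u.
Proof.
move=> uD /missableP[f mf fv]; have mf' := optimal_mate mf.
apply/(smileP _ uD); split; first by apply: contraNneq uD => <-;
  apply/missableP; exists f.
exists (cut f [set u]); split; first exact: cut_mate.
- by apply/exposedP; rewrite mem_exposed_cut set11 orbT.
- by apply/exposedP; rewrite mem_exposed_cut fv eqxx.
apply: leq_trans (card_exposed_cut _ (mateK mf')) _.
rewrite (optimal_card mf);
  have := subset_leq_card (subsetDl [set u] (exposed f)).
by rewrite cards1; clear; lia.
Qed.

Lemma A0_smiles a v : a \in A0 -> (v \in Du a) = (v \in D0).
Proof.
by move=> aA; rewrite -[[set a]]setU0 (Dm_A1 adjS aA) /missable_rest setD0.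
Qed.

Lemma optimal_cut u f : u \notin D0 -> max0 f -> optimal e [set u] (cut f [set
  u]).
Proof.
move=> uD mf; have mf' := optimal_mate mf.
have := min_exposedU1 uD; rewrite setU0 => mE; rewrite /optimal cut_mate //= mE.
apply/andP; split.
  by apply/subsetP=> x xu; rewrite mem_exposed_cut xu orbT.
apply: leq_trans (card_exposed_cut _ (mateK mf')) _.
rewrite (optimal_card mf);
  have := subset_leq_card (subsetDl [set u] (exposed f)).
by rewrite cards1; clear; lia.
Qed.

Lemma smiles_irr u : u \notin Du u.
Proof. by rewrite in_setD set11. Qed.

Lemma mate_smiles u f : u \notin D0 -> max0 f -> f u \in Du u.
Proof.
move=> uD mf; have mc := optimal_cut uD mf; rewrite in_setD in_set1.
rewrite (optimal_mem mf uD); apply/missableP; exists (cut f [set u]) => //.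
apply/exposedP; rewrite mem_exposed_cut (mateK (optimal_mate mf)) set11.
by rewrite !orbT.
Qed.

(** A mate of u is irregular for f because u is outside D(G - u), and it is exposed once f is cut at
    u. *)
Lemma irregular_cut1 u f x : x \in Du u ->
  irregular e [set u] (cut f [set u]) x = irregular e [set u] f x.
Proof.
move=> xD; have xu : x != u by apply: contraTneq xD => ->; apply: smiles_irr.
rewrite /irregular ffunE in_set1 (negbTE xu) in_set1 /=.
have [->|//] := eqVneq (f x) u; by rewrite eqxx (negbTE (smiles_irr u)) orbT.
Qed.

Lemma mate_Au u a f : u \notin D0 -> max0 f -> a \in Au u -> f a \in Du u.
Proof.
move=> uD mf aA; have := mate_A adjS (optimal_cut uD mf) aA; rewrite ffunE.
by case: ifP => // _; rewrite (negbTE (A_notin_Dm aA)).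
Qed.

Lemma irregular_mate_uniq u f x z : u \notin D0 -> max0 f ->
  x \in Du u -> z \in Q u x -> irregular e [set u] f x ->
  irregular e [set u] f z -> x = z.
Proof.
move=> uD mf xD xz ix iz.
have zD : z \in Du u by apply: subsetP (component_sub e xD) z xz.
apply: (@irregular_uniq _ e adjS [set u] set0 (cut f [set u])).
- exact: sub0set.
- by rewrite set0U optimal_cut.
- by [].
- by rewrite inE in xz.
- by rewrite irregular_cut1.
- by rewrite irregular_cut1.
Qed.

Lemma Au_notD0 u z : u \notin D0 -> z \in Au u -> z \notin D0.
Proof.
by move=> uD zA; apply: contra (A_notin_Dm zA); apply: D0_smiles.
Qed.

Lemma adj_Du u x y : x \in Du u -> y \notin Du u -> y != u -> adj x y ->
  y \in Au u.
Proof.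
move=> xD yD yu xy; apply/missable_nbrsP; split; last by exists x.
by rewrite D_Dm in_setU (negbTE yD) in_set1 (negbTE yu).
Qed.

(** Smiling vertices are exposed by a matching two short of the optimum; adding the edge between
    them makes it maximum. *)
Lemma adj_smiles_mate x y : y \notin D0 -> x \in Du y -> adj x y ->
  exists2 f, max0 f & f x = y.
Proof.
move=> yD /(smileP _ yD)[neq [f [mf fy fx le]]] xy.
exists (join f x y); last by rewrite ffunE eqxx.
rewrite /optimal (join_mate adjS) // sub0set /=.
by have := card_exposed_join fx fy neq; move: le; clear; lia.
Qed.

(** A matching showing that v and z smile, cut at u, is optimal for {z, u} and exposes v. By
    stability deleting z from G - u does not change D(G - u), so v lies there. *)
Lemma smiles_Au u z : u \notin D0 -> z \in Au u -> Du z \subset Du u.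
Proof.
move=> uD zA; have zD := Au_notD0 uD zA.
have zDu := proj1 (missable_nbrsP _ _ _ zA).
have mz := min_exposedU1 zDu; have := min_exposedU1 uD; rewrite setU0 => mu.
apply/subsetP=> v vz; have vu : v != u.
  by apply: contraTneq vz => ->; rewrite smiles_sym ?A_notin_Dm.
have /(smileP _ zD)[vz' [f [mf fz fv le]]] := vz.
rewrite -(Dm_A1 adjS zA) in_setD in_setU1 in_set1 negb_or vz' vu /=.
apply: (@D_mate _ e _ (cut f [set u])).
- exact: cut_mate.
- apply/subsetP=> x; rewrite in_setU1 mem_exposed_cut => /orP[/eqP->|->].
    by rewrite fz eqxx.
  by rewrite orbT.
- apply: leq_trans (card_exposed_cut _ (mateK mf)) _; rewrite mz mu.
  have := subset_leq_card (subsetDl [set u] (exposed f)).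
  by rewrite cards1; move: le; clear; lia.
- by apply/exposedP; rewrite mem_exposed_cut fv eqxx.
Qed.

(** * A consistent factor-component and the components of D(G - u) *)

Section Consistent.
Variable H : {set G}.
Hypotheses (HH : H \in factor_components G) (Hcons : ~~ inconsistent H).

Lemma consistent_notD x : x \in H -> x \notin D0.
Proof.
move=> xH; apply: contra Hcons => xD; apply/set0Pn; exists x.
by rewrite exposableE inE xH.
Qed.

Lemma consistent_notA x : x \in H -> x \notin A0.
Proof.
move=> xH; apply/negP=> xA; have [f mf] := optimal_ex e set0.
have := mate_A adjS mf xA; rewrite /missable_rest setD0;
  apply/negP/consistent_notD.
exact: component_mate.
Qed.

Variable u : G.
Hypothesis uH : u \in H.

Let uD : u \notin D0 := consistent_notD uH.

(* The parity of Q :&: H does not depend on the matching. *)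
Lemma exit_in_component x h f :
  x \in Du u -> h \in Q u x -> h \in H -> max0 f ->
  exists y, [/\ y \in Q u x, y \in H & f y \notin Du u].
Proof.
move=> xD hQ hH mf; pose B := Q u x :&: H.
have BD y : y \in B -> y \in Du u.
  by case/setIP=> yQ _; apply: subsetP (component_sub e xD) y yQ.
have noexp f1 : max0 f1 -> forall y, y \in B -> f1 y != y.
  by move=> mf1 y /setIP[_ /consistent_notD]; apply: optimal_mem.
have stay f1 y : max0 f1 -> y \in B -> f1 y \in Du u -> f1 y \in B.
  move=> mf1 yB fyD; have /setIP[yQ yH] := yB.
  rewrite inE (component_mate HH mf1 yH) andbT.
  apply: (component_adj yQ (BD y yB) fyD); apply: mate_adj (optimal_mate mf1) _.
  exact: noexp.
have [/exists_inP[y yB fyD]|] := boolP [exists y in B, f y \notin Du u].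
  by exists y; case/setIP: yB.
rewrite negb_exists_in => /forall_inP fB.
have {}fB y : y \in B -> f y \in Du u by move=> /fB; rewrite negbK.
have evenB : ~~ odd #|B|.
  rewrite (odd_exposed (mateK (optimal_mate mf))); last first.
    by move=> y yB; exact: (stay f y mf yB (fB y yB)).
  have -> : exposed f :&: B = set0; last by rewrite cards0.
  apply/setP=> y; rewrite in_set0 in_setI; apply/negP=> /andP[/exposedP fy yB].
  by have := noexp f mf y yB; rewrite fy eqxx.
have BI f1 : max0 f1 -> invariant_set f1 B.
  move=> mf1 y yB; apply: (stay) => //; apply: contraT => fyD.
  have f1K := mateK (optimal_mate mf1); case/negP: evenB.
  have fyB : f1 y \notin B by apply: contra fyD; apply: BD.
  have inv : invariant_set f1 (B :\ y).
    move=> z /setD1P[zy zB]; apply/setD1P; split.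
      by apply: contraNneq fyB => <-; rewrite f1K.
    apply: (stay) => //; apply: contraT => fzD; case/eqP: zy.
    have /setIP[yQ _] := yB; have /setIP[zQ _] := zB.
    apply: (@irregular_mate_uniq u f1) => //; try exact: BD.
    - by rewrite (component_eq adjS zQ).
    - by rewrite /irregular fzD orbT.
    - by rewrite /irregular fyD orbT.
  rewrite (cardsD1 y) yB oddD (odd_exposed f1K inv).
  have -> : exposed f1 :&: (B :\ y) = set0; last by rewrite cards0.
  apply/setP=> z; rewrite in_set0 in_setI; apply/negP=> /andP[/exposedP fz].
  by case/setD1P=> _ zB; have := noexp f1 mf1 z zB; rewrite fz eqxx.
have hB : h \in B by rewrite inE hQ.
have := subsetP (fcomp_min BI hB) u.
by rewrite -(fcomp_eq HH hH) uH => /(_ isT)/BD; rewrite (negbTE (smiles_irr u)).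
Qed.

Lemma exit_mem x h y f :
  x \in Du u -> h \in Q u x -> h \in H -> max0 f ->
  y \in Q u x -> f y \notin Du u -> y \in H.
Proof.
move=> xD hQ hH mf yQ fy; have [z [zQ zH fz]] := exit_in_component xD hQ hH mf.
have yD : y \in Du u by apply: subsetP (component_sub e xD) y yQ.
rewrite (@irregular_mate_uniq u f y z) //.
- by rewrite (component_eq adjS yQ).
- by rewrite /irregular fy orbT.
- by rewrite /irregular fz orbT.
Qed.

Lemma class_Au v : v \in H -> v \notin Du u -> v != u -> v \in Au u.
Proof.
move=> vH vDu vu; apply: contraT => vA.
pose Z := ~: (Du u :|: Au u :|: [set u]).
have ZI f : max0 f -> invariant_set f Z.
  move=> mf x; have fK := mateK (optimal_mate mf).
  rewrite !in_setC !in_setU in_set1 !negb_or => /andP[/andP[xD xA] xu].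
  have fxD : f x \notin Du u.
    apply: contra xA => fxD; apply: (adj_Du fxD xD xu).
    rewrite adj_sym mate_adj ?(optimal_mate mf) //.
    by apply: contraNneq xD => <-.
  rewrite in_set1 fxD /=; apply/andP; split.
    by apply: contra xD => /(mate_Au uD mf); rewrite fK.
  by apply: contraNneq xD => fx; rewrite -[x]fK fx mate_smiles.
have vZ : v \in Z by rewrite in_setC !in_setU in_set1 !negb_or vDu vA vu.
have := subsetP (fcomp_min ZI vZ) u; rewrite -(fcomp_eq HH vH) uH => /(_ isT).
by rewrite in_setC in_setU set11 orbT.
Qed.

End Consistent.

Lemma class_smiles H u v : H \in factor_components G -> ~~ inconsistent H ->
  u \in H -> v \in H -> v \notin Du u -> Du v = Du u.
Proof.
move=> HH Hc uH vH vDu; have [->//|vu] := eqVneq v u.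
have [uD vD] := (consistent_notD Hc uH, consistent_notD Hc vH).
apply/eqP; rewrite eqEsubset !smiles_Au //.
  by apply: (class_Au HH) => //; rewrite 1?eq_sym // smiles_sym.
exact: (class_Au HH).
Qed.

End FactorComponents.

(** * The set ^T U_G(S) of a consistent class *)

Section Coupper.
Variable G : graph.
Implicit Types (x y u v w z : G) (W X Z : {set G}) (f : {ffun G -> G}).

Local Notation e := (@adj G).
Local Notation max0 := (optimal e set0).
Local Notation D0 := (missable e set0).
Local Notation A0 := (missable_nbrs e set0).
Local Notation Du u := (missable_rest e [set u]).
Local Notation Au u := (missable_nbrs e [set u]).
Local Notation Q u := (component e (Du u)).
Local Notation adjS := (@adj_sym G).

Lemma kl_relE u v : u \notin D0 -> v \notin D0 ->
  kl_rel u v = (u == v) || factor_connected u v && (v \notin Du u).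
Proof.
move=> uD vD; rewrite /kl_rel; case: eqVneq => //= uv; congr (_ && _).
rewrite deficiencyE; have := deficiency_delete [set u; v]; rewrite cards2 uv.
move=> /= E; apply/idP/negP => [lt /(smileP _ uD)[_ [f [mf fu fv le]]]|nsm].
  have : min_exposed e [set u; v] <= #|exposed f|.
    by apply: min_exposed_le mf _; apply/subsetP=> x /set2P[]->;
      rewrite inE ?fu ?fv.
  by move: lt le E; clear; lia.
have [f mf] := optimal_ex e [set u; v].
rewrite ltnNge; apply/negP=> le; apply: nsm; apply/(smileP _ uD).
rewrite eq_sym uv; split=> //; exists f; split.
- exact: optimal_mate mf.
- by apply: (optimal_fix mf); rewrite set21.
- by apply: (optimal_fix mf); rewrite set22.
by rewrite (optimal_card mf); move: le E; clear; lia.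
Qed.

Variable H : {set G}.
Hypotheses (HH : H \in factor_components G) (Hcons : ~~ inconsistent H).
Variable u : G.
Hypothesis uH : u \in H.

Let uD : u \notin D0 := consistent_notD Hcons uH.

(* This is ^T U_G(S) for the class S of u, see coupper_near. *)
Definition near := [set w in Du u | [exists h in H, h \in Q u w]].

Lemma nearP w :
  reflect (w \in Du u /\ exists2 h, h \in H & h \in Q u w) (w \in near).
Proof.
have -> : (w \in near) = (w \in Du u) && [exists h in H, h \in Q u w].
  by rewrite in_set.
apply: (iffP andP) => -[wD]; first by move/exists_inP.
by move=> hP; split=> //; apply/exists_inP.
Qed.

Lemma near_smiles w : w \in near -> w \in Du u.
Proof. by case/nearP. Qed.

Lemma near_component w : w \in Du u -> w \in H -> w \in near.
Proof. by move=> wD wH; apply/nearP; split=> //; exists w => //;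
  apply: component_refl. Qed.

Lemma near_connected w z : w \in near -> z \in Q u w -> z \in near.
Proof.
case/nearP=> wD [h hH hQ] zQ; apply/nearP; split.
  by apply: subsetP (component_sub e wD) z zQ.
by exists h => //; rewrite (component_eq adjS zQ).
Qed.

Lemma near_adj w z : w \in near -> z \in Du u -> adj w z -> z \in near.
Proof.
move=> wT zD wz; apply: (near_connected wT).
by apply: component_adj (component_refl _ _ _) _ zD wz; apply: near_smiles.
Qed.

Lemma near_exit w f : w \in near -> max0 f -> f w \notin Du u -> w \in H.
Proof.
case/nearP=> wD [h hH hQ] mf; apply: (exit_mem HH Hcons uH wD hQ hH mf).
exact: component_refl.
Qed.

Lemma near_notD0 w : w \in near -> w \notin D0.
Proof.
case/nearP=> wD [h hH hQ]; apply/negP=> wD0.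
have : Q u w \subset D0.
  apply: component_min => // y z yD0 _ zDu yz; apply: contraT => zD0.
  have zA : z \in A0 by apply/missable_nbrsP; split=> //; exists y => //;
    rewrite /missable_rest setD0.
  move: zDu; rewrite smiles_sym // A0_smiles //; exact: contraLR.
by move/subsetP/(_ h hQ); apply/negP/(consistent_notD Hcons hH).
Qed.

Let X := H :|: near.

Lemma near_separating f : max0 f -> invariant_set f X.
Proof.
move=> mf x xX; rewrite in_setU; have [xH|xH] := boolP (x \in H).
  by rewrite (component_mate HH mf xH).
have xT : x \in near by move: xX; rewrite in_setU (negbTE xH).
apply/orP; right; have [fxD|fxD] := boolP (f x \in Du u).
  apply: (near_adj xT fxD); apply: (mate_adj (optimal_mate mf)).
  exact: optimal_mem mf (near_notD0 xT).
by rewrite (near_exit xT mf fxD) in xH.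
Qed.

(* Swapping a matching exposing w and u with f along its path from w stops at
   the first vertex r matched into H; this shows that w can be exposed in
   G[X] / H. *)
Lemma near_critical :
  factor_critical (contract [set x : induced X | val x \in H]).
Proof.
apply/contract_criticalP; first exact: subsetUl.
have [f mf] := optimal_ex e set0; have mf' := optimal_mate mf;
  have fK := mateK mf'.
have fY x : x \in X :\: H -> f x \in X :\: H.
  case/setDP=> xX xH; rewrite in_setD near_separating // andbT.
  by rewrite (invariant_mem _ fK) //; apply: component_mate.
have fne x : x \in X :\: H -> f x != x.
  case/setDP=> xX xH; apply: optimal_mem mf (near_notD0 _).
  by move: xX; rewrite in_setU (negbTE xH).
split.
  exists (cut f (~: (X :\: H))); first exact: cut_mate.
  apply/setP=> x; rewrite mem_exposed_cut !in_setC.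
  have [xY|xY] //= := boolP (x \in X :\: H); last by rewrite orbT.
  by rewrite fY // orbF (negbTE (fne x xY)).
move=> w wY; have /setDP[wX wH] := wY.
have wT : w \in near by move: wX; rewrite in_setU (negbTE wH).
have wD := near_smiles wT.
have /(smileP _ uD)[wu [L [mL Lu Lw leL]]] := wD.
have := min_exposedU1 uD; rewrite setU0 => mE.
have maxL : optimal e (set0 :|: [set u]) L.
  rewrite set0U /optimal mL mE leL andbT /=.
  by apply/subsetP=> x /set1P->; apply/exposedP.
pose Y := Q u w :\: H.
have YX : Y \subset X :\: H.
  apply/subsetP=> y /setDP[yQ yH]; rewrite in_setD yH in_setU.
  by rewrite (near_connected wT yQ) orbT.
have YD y : y \in Y -> y \in Du u.
  by case/setDP=> yQ _; apply: subsetP (component_sub e wD) y yQ.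
have fYI : invariant_set f Y.
  move=> y yY; have /setDP[yQ yH] := yY.
  rewrite in_setD (invariant_mem _ fK); last exact: component_mate.
  rewrite yH /=; apply: (component_adj yQ (YD y yY)); last first.
    by apply: mate_adj => //; apply: fne; apply: subsetP YX y yY.
  by apply: contraR yH => fyD; apply: near_exit (near_connected wT yQ) mf fyD.
pose L1 := cut L (~: Y).
have mL1 : mate e L1 by apply: cut_mate.
have L1w : L1 w = w by apply/exposedP; rewrite mem_exposed_cut Lw eqxx.
have L1Y : invariant_set L1 Y.
  move=> y yY; rewrite ffunE !in_setC; case: ifP => //.
  by move/negbT; rewrite negb_or !negbK => /andP[].
have [K [wK fI LI Kmin ends]] := orbit_endsP fK (mateK mL1) L1w.
have wYY : w \in Y by rewrite in_setD wH component_refl.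
have KY : K \subset Y by apply: Kmin.
case: ends => [r rK fE _|r rK rw fE LE].
  have /setIP[/exposedP fr _] : r \in exposed f :&: K by rewrite fE set11.
  have := fne r (subsetP YX r (subsetP KY r rK)); by rewrite fr eqxx.
have rY := subsetP KY r rK; have /setDP[rQ rH] := rY.
have irr z : z \in Q u w -> irregular e [set u] L z -> w = z.
  move=> zQ iz; apply: (@irregular_uniq _ e adjS [set u] set0 L) => //.
  - exact: sub0set.
  - by rewrite inE in zQ.
  - by rewrite /irregular Lw eqxx.
have /norP[Lr LrD] : ~~ irregular e [set u] L r.
  by apply: contra rw => /(irr r rQ) ->.
rewrite negbK in LrD.
have L1r : L1 r = r.
  by have /setIP[/exposedP] : r \in exposed L1 :&: K by rewrite LE set22.
have LrH : L r \in H.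
  have /exposedP := L1r; rewrite mem_exposed_cut !in_setC (negbTE Lr) rY /=.
  rewrite in_setD negb_and negbK => /orP[//|].
  by rewrite (component_adj rQ (YD r rY) LrD) ?mate_adj.
exists (cut (swap f L1 K) (~: (X :\: H))), r, (L r); split=> //.
- by apply/cut_mate/swap_mate.
- exact: subsetP YX r rY.
- by rewrite adj_sym mate_adj.
split=> //; apply/setP=> x; rewrite mem_exposed_cut !in_setU1 !in_setC.
have [xY|xY] := boolP (x \in X :\: H); last by rewrite !orbT.
rewrite /= orbF; have [xK|xK] := boolP (x \in K).
  rewrite ffunE xK (subsetP YX _ (subsetP KY _ (LI x xK))) orbF.
  by have /setP/(_ x) := LE; rewrite !inE xK andbT.
have -> : swap f L1 K x = f x by rewrite ffunE (negbTE xK).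
rewrite (negbTE (fne x xY)) fY //=; apply/esym/norP.
by split; apply: contraNneq xK => ->.
Qed.

Lemma near_upper W : W \in factor_components G -> W \subset X -> fc_le H W.
Proof.
move=> WW WX; apply/existsP; exists X; rewrite near_critical andbT.
apply/andP; split; first exact/separatingP/near_separating.
by apply/subUsetP; split; rewrite ?subsetUl.
Qed.

Lemma fcomp_near w : w \in near -> fcomp w \subset X.
Proof.
move=> wT; apply: fcomp_min near_separating _.
by rewrite in_setU wT orbT.
Qed.

Lemma mem_upper w : w \in upper H = fc_le H (fcomp w) && (w \notin H).
Proof.
apply/bigcupP/andP => [[W /andP[WW /andP[HW WnH]] wW]|[HW wH]].
  rewrite -(fcomp_eq WW wW) HW; split=> //; apply: contra WnH => wH.
  by rewrite (fcomp_eq WW wW) (fcomp_eq HH wH).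
exists (fcomp w); last exact: fcomp_refl.
rewrite fcomp_component HW /=; apply: contraNneq wH => <-; exact: fcomp_refl.
Qed.

Lemma mem_upper_star w : w \in upper_star H = fc_le H (fcomp w).
Proof.
apply/bigcupP/idP => [[W /andP[WW HW] wW]|HW].
  by rewrite -(fcomp_eq WW wW).
by exists (fcomp w); rewrite ?fcomp_component ?fcomp_refl.
Qed.

Lemma upperP y f : y \in upper H -> max0 f -> exists L r h,
  [/\ mate e L, #|exposed L| <= min_exposed e set0 + 2, L y = y, L r = r
    & [/\ r != y, r \in upper H, h \in H, adj h r
        & forall x, x \in H -> L x = f x]].
Proof.
rewrite mem_upper => /andP[/existsP[Z /and3P[/separatingP ZI /subUsetP[HZ
  yZ]]]].
move=> critZ yH mf; have /(contract_criticalP HZ)[_ crit] := critZ.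
have mf' := optimal_mate mf; have fK := mateK mf'.
have yZH : y \in Z :\: H by rewrite in_setD yH (subsetP yZ) ?fcomp_refl.
have [g [r [h [mg rZ hH hr [ry gE]]]]] := crit y yZH.
have fI : invariant_set f (Z :\: H).
  move=> x /setDP[xZ xH]; rewrite in_setD ZI // andbT.
  by rewrite (invariant_mem _ fK) //; apply: component_mate.
have gI : invariant_set g (Z :\: H).
  rewrite -[Z :\: H]setCK; apply: invariant_setC; first exact: mateK mg.
  move=> x xZ; have /exposedP-> // : x \in exposed g.
  by rewrite gE !in_setU1 xZ !orbT.
exists (swap f g (Z :\: H)), r, h; split.
- exact: swap_mate.
- have := card_exposed_swap f g (Z :\: H); rewrite (optimal_card mf).
  have : exposed g :&: (Z :\: H) \subset [set y; r].
    apply/subsetP=> x /setIP[]; rewrite gE !in_setU1 in_set1 in_setC => xE xZ.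
    by move: xE; rewrite xZ orbF.
  move/subset_leq_card; rewrite cards2.
  by case: (y != r); clear; lia.
- by rewrite ffunE yZH; apply/exposedP; rewrite gE setU11.
- by rewrite ffunE rZ; apply/exposedP; rewrite gE in_setU1 setU11 orbT.
split=> //; last first.
  by move=> x xH; rewrite ffunE in_setD xH.
have /setDP[rZ' rH] := rZ; rewrite mem_upper rH andbT.
apply/existsP; exists Z; apply/and3P; split; first exact/separatingP.
  by apply/subUsetP; split=> //; apply: fcomp_min.
exact: critZ.
Qed.

Lemma component_upper_near x p y : p \in Du u -> p \in H ->
  x \in Q u p -> y \in upper H -> adj x y -> y \in Q u p.
Proof.
move=> pD pH xQ yU xy;
  have xD : x \in Du u by apply: subsetP (component_sub e pD) x xQ.
have [yD|yD] := boolP (y \in Du u); first exact: component_adj xQ xD yD xy.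
have yH : y \notin H by move: yU; rewrite mem_upper => /andP[].
have yu : y != u by apply: contraNneq yH => ->.
have yA := adj_Du xD yD yu xy; have yD0 := Au_notD0 uD yA.
have sub := smiles_Au uD yA.
have [f mf] := optimal_ex e set0.
have [L [r [h [mL leL Ly Lr [ry rU hH hr LH]]]]] := upperP yU mf.
have rDy : r \in Du y by apply/(smileP _ yD0); split=> //; exists L.
have hy : h != y by apply: contraNneq yH => <-.
have [hD|hD] := boolP (h \in Du u).
  have rD := subsetP sub r rDy.
  have rQ : r \in Q u h by apply: component_adj (component_refl _ _ _) hD rD hr.
  have [z [zQ zH fz]] :=
    exit_in_component HH Hcons uH hD (component_refl _ _ _) hH mf.
  have zD : z \in Du u by apply: subsetP (component_sub e hD) z zQ.
  have Lz : L z = f z by apply: LH.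
  have rH : r \notin H by move: rU; rewrite mem_upper => /andP[].
  case/negP: rH; suff -> : r = z by [].
  have [mu my] := (min_exposedU1 uD,
    min_exposedU1 (proj1 (missable_nbrsP _ _ _ yA))).
  rewrite setU0 in mu.
  have zu : z != u by apply: contraTneq zD => ->; apply: smiles_irr.
  apply: (@irregular_uniq _ e adjS [set u] [set y] (cut L [set u])) => //.
  - by rewrite sub1set.
  - rewrite /optimal cut_mate //=; apply/andP; split.
      apply/subsetP=> v; rewrite in_setU1 mem_exposed_cut => /orP[/eqP->|->].
        by rewrite Ly eqxx.
      by rewrite orbT.
    apply: leq_trans (card_exposed_cut _ (mateK mL)) _; rewrite my mu.
    have := subset_leq_card (subsetDl [set u] (exposed L)).
    by rewrite cards1; move: leL; clear; lia.
  - by move: zQ; rewrite -(component_eq adjS rQ) inE.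
  - by rewrite irregular_cut1 // /irregular Lr eqxx.
  - by rewrite irregular_cut1 // /irregular Lz fz orbT.
have Dh : Du h = Du u by apply: (class_smiles HH).
have hD0 := consistent_notD Hcons hH.
have hDy : h \notin Du y by rewrite smiles_sym // Dh.
have hA : h \in Au y by apply: adj_Du rDy hDy hy _; rewrite adj_sym.
have xDy : x \in Du y by apply: (subsetP (smiles_Au yD0 hA)); rewrite Dh.
have [f1 mf1 f1x] := adj_smiles_mate yD0 xDy xy.
have xn : x \in near by apply: near_connected xQ; apply: near_component.
have xH : x \in H by apply: near_exit xn mf1 _; rewrite f1x.
by have := component_mate HH mf1 xH; rewrite f1x (negbTE yH).
Qed.

Lemma upper_component_near w : w \in upper H ->
  ~~ (neighbours (component e (upper H) w) :&: H \subset H :\: Du u) ->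
  w \in near.
Proof.
move=> wU /subsetPn[p /setIP[]];
  rewrite inE => /andP[pK /exists_inP[k kK kp]] pH.
rewrite in_setD pH andbT negbK => pD.
have kU : k \in upper H by apply: subsetP (component_sub e wU) k kK.
have kQ : k \in Q u p.
  apply: (component_upper_near pD pH (component_refl _ _ _) kU).
  by rewrite adj_sym.
have sub : component e (upper H) k \subset Q u p.
  apply: component_min kQ _ => y z yQ _ zU yz.
  exact: (component_upper_near pD pH yQ zU yz).
apply: near_connected (near_component pD pH) _; apply: (subsetP sub).
by rewrite (component_eq adjS kK) component_refl.
Qed.

Lemma fcomp_sub_component w : w \in upper H ->
  fcomp w \subset component e (upper H) w.
Proof.
move=> wU; have /andP[Hw wH] : fc_le H (fcomp w) && (w \notin H) by rewrite
  -mem_upper.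
apply/subsetP=> y; rewrite !inE => /connectP[p].
have fU x : factor_connected w x -> x \in upper H.
  move=> wx; have xw : x \in fcomp w by rewrite inE.
  rewrite mem_upper -(fcomp_eq (fcomp_component w) xw) Hw.
  apply: contra wH => xH; rewrite (fcomp_eq HH xH).
  by rewrite -(fcomp_eq (fcomp_component w) xw) fcomp_refl.
elim/last_ind: p y => [|p z IHp] y /=; first by move=> _ ->; apply: connect0.
rewrite rcons_path last_rcons => /andP[wp pz] ->.
have wl : factor_connected w (last w p) by apply/connectP; exists p.
apply: connect_trans (IHp _ wp erefl) _; apply: connect1.
rewrite /rel_in fU // fU ?allowed_adj //.
exact: connect_trans wl (connect1 pz).
Qed.

Lemma mem_upper_of S w : w \in upper_of H S =
  (w \in upper H) && (neighbours (component e (upper H) w) :&: H \subset S).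
Proof.
apply/bigcupP/andP => [[W /andP[WW /and3P[HW WnH /exists_inP[K]]]]|[wU NS]].
  rewrite components_inE => /imsetP[k kU ->] /andP[/subsetP WK NS] wW.
  have wK := WK w wW; rewrite (component_eq adjS wK); split=> //.
  by apply: subsetP (component_sub e kU) w wK.
have /andP[Hw wH] : fc_le H (fcomp w) && (w \notin H) by rewrite -mem_upper.
exists (fcomp w); last exact: fcomp_refl.
rewrite fcomp_component Hw /=; apply/andP; split.
  by apply: contraNneq wH => <-; apply: fcomp_refl.
apply/exists_inP; exists (component e (upper H) w).
  by rewrite components_inE imset_f.
by rewrite fcomp_sub_component.
Qed.

Lemma coupper_near : coupper_of H (H :\: Du u) = near.
Proof.
rewrite /coupper_of (negbTE Hcons) /=; apply/setP=> w.
rewrite 3!in_setD mem_upper_star mem_upper_of mem_upper.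
apply/idP/idP => [/and3P[nup wS Hw]|wT].
  have [wH|wH] := boolP (w \in H).
    by apply: near_component => //; move: wS; rewrite wH andbT negbK.
  have wU : w \in upper H by rewrite mem_upper Hw.
  by apply: upper_component_near => //; move: nup; rewrite Hw wH.
have Hw : fc_le H (fcomp w) by rewrite near_upper ?fcomp_component ?fcomp_near.
rewrite (near_smiles wT) Hw /= andbT.
apply/negP=> /andP[wH NS]; have /nearP[wD [h hH hQ]] := wT.
have wU : w \in upper H by rewrite mem_upper Hw.
pose K := component e (upper H) w.
have KH x : x \in K -> x \notin H.
  by move/(subsetP (component_sub e wU)); rewrite mem_upper => /andP[].
have : Q u w \subset K :&: Q u w.
  apply: component_min; first by rewrite in_setI !component_refl.
  move=> y z /setIP[yK yQ] yD zD yz.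
  have zQ : z \in Q u w by apply: component_adj yQ yD zD yz.
  rewrite in_setI zQ andbT; have [zH|zH] := boolP (z \in H).
    have : z \in neighbours K :&: H.
      rewrite in_setI zH andbT inE in_setC (contraL (KH z) zH) /=.
      by apply/exists_inP; exists y.
    by move/(subsetP NS); rewrite in_setD zD.
  have zT := near_connected wT zQ.
  apply: (component_adj yK _ _ yz);
    first exact: subsetP (component_sub e wU) y yK.
  by rewrite mem_upper zH andbT near_upper ?fcomp_component ?fcomp_near.
by move/subsetP/(_ h hQ)/setIP=> [/KH]; rewrite hH.
Qed.

End Coupper.

(** * DM components *)

Section DMComponents.
Variable G : graph.
Implicit Types (x y u v w z : G) (H S : {set G}) (f : {ffun G -> G}).
Implicit Types C : dm_component G.

Local Notation e := (@adj G).
Local Notation max0 := (optimal e set0).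
Local Notation D0 := (missable e set0).
Local Notation A0 := (missable_nbrs e set0).
Local Notation Du u := (missable_rest e [set u]).
Local Notation Au u := (missable_nbrs e [set u]).
Local Notation adjS := (@adj_sym G).

Definition kl_class x := [set y in ~: D0 | kl_rel x y].

Lemma kl_classesE : kl_classes G = [set kl_class x | x in ~: D0].
Proof. by rewrite /kl_classes exposableE. Qed.

Lemma inconsistent_sub H x : H \in factor_components G -> inconsistent H ->
  x \in H -> x \notin D0 -> x \in A0.
Proof.
move=> HH Hinc xH xD; apply: contraT => xA.
have cI f : max0 f -> invariant_set f (~: (D0 :|: A0)).
  move=> mf z; rewrite !in_setC !in_setU => /norP[zD zA].
  have fz := optimal_mem mf zD; have fK := mateK (optimal_mate mf).
  apply/norP; split.
    apply: contra zA => fzD; apply/missable_nbrsP; split=> //; exists (f z).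
      by rewrite /missable_rest setD0.
    by rewrite adj_sym mate_adj ?(optimal_mate mf).
  by apply: contra zD => /(mate_A adjS mf); rewrite fK /missable_rest setD0.
have := @fcomp_min _ _ x cI; rewrite -(fcomp_eq HH xH).
rewrite in_setC in_setU negb_or xD xA => /(_ isT)/subsetP sub.
case/set0Pn: Hinc => y /setIP[/sub]; rewrite exposableE in_setC in_setU.
by move=> /norP[/negbTE->].
Qed.

Lemma kl_class_refl x : x \notin D0 -> x \in kl_class x.
Proof. by move=> xD; rewrite !inE /kl_rel eqxx; move: xD;
  rewrite inE => ->. Qed.

Lemma mem_kl_class x y : x \notin D0 ->
  (y \in kl_class x) = [&& y \notin D0, factor_connected x y & y \notin Du x].
Proof.
move=> xD; have -> : (y \in kl_class x) = (y \notin D0) && kl_rel x y.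
  by rewrite in_set in_setC.
have [//|yD] /= := boolP (y \in D0); rewrite kl_relE //.
have [<-|//] := eqVneq; by rewrite smiles_irr /factor_connected connect0.
Qed.

Lemma dm_component_factor C : (val C).1 \in factor_components G.
Proof. by have := valP C; rewrite inE => /andP[]. Qed.

Lemma dm_base_kl C : dm_base C \in kl_of (val C).1.
Proof. by have := valP C; rewrite inE => /andP[]. Qed.

Lemma consistent_spec C : ~~ inconsistent (val C).1 ->
  exists2 u, u \in dm_base C & dm_base C = (val C).1 :\: Du u.
Proof.
move=> Hc; have HH := dm_component_factor C; have := dm_base_kl C.
rewrite /kl_of (negbTE Hc) /= inE kl_classesE => /andP[/imsetP[x]].
rewrite in_setC => xD SE; rewrite SE => /subsetP sub.
have xS := kl_class_refl xD; have xH := sub x xS.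
exists x => //; apply/setP=> y; rewrite mem_kl_class // in_setD.
have -> : factor_connected x y = (y \in (val C).1).
  by rewrite (fcomp_eq HH xH) inE.
have [yH|yH] := boolP (y \in (val C).1); last by rewrite !andbF.
by rewrite (consistent_notD Hc yH) andbT.
Qed.

Lemma consistent_base C u : ~~ inconsistent (val C).1 -> u \in dm_base C ->
  [/\ u \in (val C).1, dm_base C = (val C).1 :\: Du u
    & dm_coupper C = near (val C).1 u].
Proof.
move=> Hc uC; have HH := dm_component_factor C.
have [x xC CE] := consistent_spec Hc.
have xH : x \in (val C).1 by move: xC; rewrite CE => /setDP[].
have /setDP[uH uDx] : u \in (val C).1 :\: Du x by rewrite -CE.
have E : dm_base C = (val C).1 :\: Du u.
  by rewrite (class_smiles HH Hc xH uH uDx).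
split=> //; rewrite /dm_coupper -/(dm_base C) E.
exact: coupper_near.
Qed.

Lemma inconsistent_base C : inconsistent (val C).1 ->
  dm_base C = (val C).1 :&: A0 /\ dm_coupper C = (val C).1 :&: D0.
Proof.
move=> Hi; have HH := dm_component_factor C.
suff E : dm_base C = (val C).1 :&: A0.
  split=> //; rewrite /dm_coupper /coupper_of Hi -/(dm_base C) E.
  by rewrite exposable_nbrsE exposableE eqxx.
have := dm_base_kl C; rewrite /kl_of Hi /= exposable_nbrsE.
case: eqP => [->|_]; first by move/set1P.
rewrite inE kl_classesE => /andP[/imsetP[x]].
rewrite in_setC => xD SE; rewrite SE => /subsetP sub.
have xS := kl_class_refl xD; have xH := sub x xS.
have xA := inconsistent_sub HH Hi xH xD.
apply/setP=> y; rewrite mem_kl_class // A0_smiles // andbCA andbb in_setI.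
have -> : factor_connected x y = (y \in (val C).1).
  by rewrite (fcomp_eq HH xH) inE.
have [yH|//] := boolP (y \in (val C).1).
apply/idP/idP => [|/missable_nbrsP[]//]; exact: inconsistent_sub HH Hi yH.
Qed.

Lemma base_notD C u : u \in dm_base C -> u \notin D0.
Proof.
have [Hi|Hc] := boolP (inconsistent (val C).1).
  by rewrite (inconsistent_base Hi).1 => /setIP[_ /missable_nbrsP[]].
by case/(consistent_base Hc) => uH _ _; exact: (consistent_notD Hc uH).
Qed.

Lemma base_component C u : u \in dm_base C -> (val C).1 = fcomp u.
Proof.
move=> uC; apply: (fcomp_eq (dm_component_factor C)); move: uC.
have [Hi|Hc] := boolP (inconsistent (val C).1).
  by rewrite (inconsistent_base Hi).1 => /setIP[].
by case/(consistent_base Hc).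
Qed.

Lemma consistent_notA0 C u : u \in dm_base C -> u \notin A0 ->
  ~~ inconsistent (val C).1.
Proof.
move=> uC uA; apply: contraTN uC => /inconsistent_base[-> _].
by rewrite in_setI (negbTE uA) andbF.
Qed.

Lemma base_smiles C u v : u \in dm_base C -> v \in dm_base C -> Du u = Du v.
Proof.
move=> uC vC; have [Hi|Hc] := boolP (inconsistent (val C).1).
  move: uC vC; rewrite (inconsistent_base Hi).1 => /setIP[_ uA] /setIP[_ vA].
  by apply/setP=> x; rewrite !A0_smiles.
have [vH vE _] := consistent_base Hc vC.
move: uC; rewrite vE => /setDP[uH uDv].
exact: (class_smiles (dm_component_factor C)).
Qed.

Lemma base_ex v : v \notin D0 -> exists C, v \in dm_base C.
Proof.
move=> vD; have vP : (fcomp v, kl_class v) \in bases G.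
  rewrite inE fcomp_component /= /kl_of exposable_nbrsE.
  case: ifP => [/andP[Hi /eqP HA]|_].
    have : v \in fcomp v :&: A0.
      rewrite in_setI fcomp_refl.
      exact: inconsistent_sub (fcomp_component v) Hi (fcomp_refl v) vD.
    by rewrite HA inE.
  rewrite inE kl_classesE imset_f ?in_setC //=.
  by apply/subsetP=> y; rewrite mem_kl_class // => /and3P[_ vy _]; rewrite inE.
by exists (exist _ (fcomp v, kl_class v) vP : dm_component G);
  apply: kl_class_refl.
Qed.

Lemma smiles_consistent C u v : u \in dm_base C -> v \in Du u -> v \notin D0 ->
  ~~ inconsistent (val C).1.
Proof.
move=> uC vu vD; apply: (consistent_notA0 uC); apply: contra vD => uA.
by rewrite -(A0_smiles _ uA).
Qed.

Lemma dm_le_coupper C C' : dm_le C C' ->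
  (inconsistent (val C).1 -> dm_coupper C' \subset D0) /\
  (~~ inconsistent (val C).1 -> forall u w, u \in dm_base C ->
     w \in dm_coupper C' -> w \notin D0 -> w \in Du u).
Proof.
case/connectP=> p; elim: p C => [|C1 p IHp] C /=.
  move=> _ ->; split=> [Hi|Hc u w uC].
    by rewrite (inconsistent_base Hi).2 subsetIr.
  by have [_ _ ->] := consistent_base Hc uC => /near_smiles.
case/andP=> le0 C1p lastE; have {IHp C1p lastE} [IHi IHc] := IHp C1 C1p lastE.
case/orP: le0 => [/eqP->//|/set0Pn[z /setIP[]]].
rewrite [z \in neighbours _]inE in_setC => /andP[zN /exists_inP[y yC yz]] zC1.
have zD := base_notD zC1; split=> [Hi|Hc u w uC wC' wD].
  have [_ CE] := inconsistent_base Hi; apply: IHi; apply: contraT => H1c.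
  have [zH _ _] := consistent_base H1c zC1.
  case/negP: (consistent_notA (dm_component_factor C1) H1c zH).
  apply/missable_nbrsP; split=> //; exists y => //;
    rewrite /missable_rest setD0.
  by move: yC; rewrite CE => /setIP[].
have [uH _ CE] := consistent_base Hc uC; rewrite CE in yC zN.
have HH := dm_component_factor C; have uD := consistent_notD Hc uH.
have H1c : ~~ inconsistent (val C1).1.
  apply: contra wD => /IHi/subsetP; exact.
have wz := IHc H1c z w zC1 wC' wD.
have zDu : z \notin Du u by apply: contra zN => zDu; apply: near_adj yC zDu yz.
have [<-//|zu] := eqVneq z u.
apply: (subsetP (smiles_Au uD _)) wz.
exact: adj_Du (near_smiles yC) zDu zu yz.
Qed.

Lemma dm_smile_smiles C1 C2 : dm_smile C1 C2 ->
  [/\ ~~ inconsistent (val C1).1, dm_base C2 != set0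
    & forall u v, u \in dm_base C1 -> v \in dm_base C2 -> v \in Du u].
Proof.
case/existsP=> C /andP[le /andP[C2n0 /subsetP sub]].
have subC v : v \in dm_base C2 -> v \in dm_coupper C.
  by move=> /sub/setDP[/setUP[->//|]].
have [lei lec] := dm_le_coupper le.
have Hc : ~~ inconsistent (val C1).1.
  apply/negP=> /lei/subsetP CD; case/set0Pn: C2n0 => v vC2.
  by case/negP: (base_notD vC2); apply/CD/subC.
split=> // u v uC1 vC2; apply: (lec Hc) => //; first exact: subC.
exact: base_notD vC2.
Qed.

(* Along an alternating path from u to v, the first edge z -- s leaving the part
   of the path outside of H :|: near H u leads from v to a vertex z of A(G - u)
   with D(G - z) strictly smaller than D(G - u). *)
Lemma smiles_reach C u v : u \in dm_base C -> v \in Du u -> v \notin D0 ->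
  exists C', [/\ dm_le C C', ~~ inconsistent (val C').1 & v \in dm_coupper C'].
Proof.
have [k] := ubnP #|Du u|; elim: k C u => // k IHk C u ltk uC vDu vD.
have Hc := smiles_consistent uC vDu vD.
have [uH _ CE] := consistent_base Hc uC; have HH := dm_component_factor C.
have uD := consistent_notD Hc uH; set H := (val C).1 in Hc uH CE HH.
have [vT|vT] := boolP (v \in near H u).
  by exists C; split; rewrite ?CE // /dm_le connect0.
pose X := H :|: near H u.
have vX : v \notin X.
  rewrite in_setU (negbTE vT) orbF; apply: contra vT.
  exact: near_component.
have [f mf] := optimal_ex e set0; have mf' := optimal_mate mf;
  have fK := mateK mf'.
have fX := invariant_setC fK (near_separating HH Hc uH mf).
have /(smileP _ uD)[vu [L [mL Lu Lv leL]]] := vDu; have LK := mateK mL.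
pose L1 := cut L X; have mL1 : mate e L1 by apply: cut_mate.
have L1v : L1 v = v by apply/exposedP; rewrite mem_exposed_cut Lv eqxx.
have L1X : invariant_set L1 (~: X).
  move=> x xX; rewrite in_setC in xX; rewrite in_setC ffunE (negbTE xX) /=.
  by case: ifP => [|/negbT].
have [K [vK fI LI Kmin ends]] := orbit_endsP fK (mateK mL1) L1v.
have KX x : x \in K -> x \notin X.
  rewrite -in_setC => xK; apply: subsetP (Kmin _ fX L1X _) x xK.
  by rewrite in_setC.
have cs := card_exposed_swap f L1 K; rewrite (optimal_card mf) in cs.
case: ends => [z zK fE LE|z zK zv fE LE].
  case/negP: vD; apply: (@D_mate _ e _ (swap f L1 K)).
  - exact: swap_mate.
  - exact: sub0set.
  - by move: cs; rewrite fE LE !cards1; clear; lia.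
  - by rewrite ffunE vK.
have L1z : L1 z = z.
  by have /setIP[/exposedP] : z \in exposed L1 :&: K by rewrite LE set22.
have zX := KX z zK; pose L' := cut L [set z].
have mL' : mate e L' by apply: cut_mate.
have L'E x : x \in K -> L' x = L1 x.
  move=> xK; have xX := KX x xK; rewrite !ffunE (negbTE xX) !in_set1 /=.
  have [->|xz] := eqVneq x z.
    by have := L1z; rewrite ffunE (negbTE zX) /= => ->.
  have [Lxz|Lxz] /= := eqVneq (L x) z.
    have := L1z; rewrite -Lxz ffunE LK Lxz (negbTE zX) (negbTE xX) /= => E.
    by rewrite E eqxx in xz.
  case: ifP => // LxX; have : x \in exposed L1 :&: K.
    by rewrite in_setI xK mem_exposed_cut LxX !orbT.
  by rewrite LE => /set2P[] xE; [rewrite xE Lv in LxX;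
    case/negP: vX | case/eqP: xz].
have L'I : invariant_set L' K by move=> x xK; rewrite L'E // LI.
have L'K : exposed L' :&: K = [set v; z].
  rewrite -LE; apply/setP=> x; rewrite !in_setI; have [xK|] := boolP (x \in K).
    by rewrite !andbT inE L'E // inE.
  by rewrite !andbF.
have Kout x : x \in X -> x \notin K by move=> xX; apply: contraL xX; apply: KX.
have uX : u \in X by rewrite in_setU uH.
pose L2 := swap L' f K; have mL2 : mate e L2 by apply: swap_mate.
have L2out x : x \in X -> x \in exposed L' -> L2 x = x.
  by move=> /Kout xK /exposedP L'x; rewrite ffunE (negbTE xK).
have L2u : L2 u = u by apply: L2out => //; rewrite mem_exposed_cut Lu eqxx.
have cL2 : #|exposed L2| <= min_exposed e set0 + 2 * #|[set z] :\: exposed L|.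
  have := card_exposed_swap L' f K; rewrite L'K fE cards0 cards2 eq_sym zv /L2.
  have := card_exposed_cut [set z] LK; rewrite -/L'.
  by move: leL; clear; lia.
have Lz : L z != z.
  apply: contra uD => Lz; apply: (D_mate mL2 (sub0set _)) L2u.
  apply: leq_trans cL2 _; have -> : [set z] :\: exposed L = set0.
    by apply/eqP; rewrite setD_eq0 sub1set inE.
  by rewrite cards0 addn0.
have leL2 : #|exposed L2| <= min_exposed e set0 + 2.
  apply: leq_trans cL2 _;
    have := subset_leq_card (subsetDl [set z] (exposed L)).
  by rewrite cards1; clear; lia.
pose s := L z; have sX : s \in X.
  have : z \in exposed L1 by apply/exposedP.
  by rewrite mem_exposed_cut (negbTE Lz) (negbTE zX).
have zs : adj z s by apply: mate_adj.
have su : s != u by apply: contraNneq zX => E; rewrite -[z]LK -/s E Lu.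
have sDu : s \in Du u.
  apply/(smileP _ uD); split=> //; exists L2; split=> //.
  by apply: L2out; rewrite // mem_exposed_cut LK set11 !orbT.
have sT : s \in near H u.
  by move: sX; rewrite in_setU => /orP[sH|//]; apply: near_component.
have zT : z \notin near H u by move: zX; rewrite in_setU negb_or => /andP[].
have sz : adj s z by rewrite adj_sym.
have zDu : z \notin Du u by apply: contra zT => zDu; apply: near_adj sT zDu sz.
have zu : z != u by apply: contraNneq zX => ->.
have zA := adj_Du sDu zDu zu sz; have zD := Au_notD0 uD zA.
have vDz : v \in Du z.
  apply/(smileP _ zD); rewrite eq_sym; split=> //; exists (swap f L1 K); split.
  - exact: swap_mate.
  - by rewrite ffunE zK.
  - by rewrite ffunE vK.
  - by move: cs; rewrite fE LE cards0 cards2 eq_sym zv; clear; lia.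
have sDz : s \notin Du z.
  apply: contra zX => sDz; have [g mg gs] := adj_smiles_mate zD sDz sz.
  have sH : s \in H by apply: (near_exit HH Hc uH sT mg); rewrite gs.
  by rewrite -gs in_setU (component_mate HH mg sH).
have ltz : #|Du z| < #|Du u|.
  apply: proper_card; apply/properP; split; first exact: smiles_Au.
  by exists s.
have [Cz zCz] := base_ex zD.
have [C' [le' Hc' vC']] := IHk Cz z (leq_trans ltz ltk) zCz vDz vD.
exists C'; split=> //; apply: connect_trans (connect1 _) le'.
rewrite /dm_le0; apply/orP; right; apply/set0Pn; exists z.
rewrite in_setI zCz andbT inE in_setC CE zT /=.
by apply/exists_inP; exists s.
Qed.

Lemma smiles_dm_smile C1 C2 u v : u \in dm_base C1 -> v \in dm_base C2 ->
  v \in Du u -> dm_smile C1 C2.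
Proof.
move=> uC1 vC2 vDu; have vD := base_notD vC2.
have [C [le Hc vC]] := smiles_reach uC1 vDu vD.
apply/existsP; exists C; rewrite le /=; apply/andP; split.
  by apply/set0Pn; exists v.
have [w wC _] := consistent_spec Hc; have [wH BE CE] := consistent_base Hc wC.
have HH := dm_component_factor C; have wD := consistent_notD Hc wH.
have vN : v \in near (val C).1 w by rewrite -CE.
have vDw := near_smiles vN.
have H2c : ~~ inconsistent (val C2).1.
  by apply: (smiles_consistent vC2 _ wD); rewrite smiles_sym.
apply/subsetP=> v' v'C2; have v'D := base_notD v'C2.
have v'w : v' \in Du w.
  by rewrite smiles_sym // (base_smiles v'C2 vC2) smiles_sym.
rewrite in_setD BE in_setD v'w /= /dm_vertices in_setU CE; apply/orP; right.
have : v' \in fcomp v.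
  by rewrite -(base_component vC2) (base_component v'C2) fcomp_refl.
move/(subsetP (fcomp_near HH Hc wH vN)); rewrite in_setU => /orP[v'H|//].
exact: near_component.
Qed.

End DMComponents.

Theorem theorem7p4 (G : graph) (X : {set G}) :
  maximal_barrier X <->
  exists I : {set dm_component G},
    [/\ upper_ideal (@dm_le G) I,
        legitimate (@dm_smile G) I,
        spanning (@dm_smile G) I,
        normalized I
      & X = \bigcup_(C in I) dm_base C].
Proof.
rewrite maximal_barrierE; apply: (iff_trans (maxset_tightP (@adj_sym G) X)).
split=> [[XD Xfree Xmax]|[I [_ legI spanI _ XE]]].
  have closed C v v' : v \in X -> v \in dm_base C -> v' \in dm_base C ->
      v' \in X.
    move=> vX vC v'C; apply: contraT => v'X.
    have [w wX] := Xmax v' v'X (base_notD v'C).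
    by rewrite (base_smiles v'C vC) (negbTE (Xfree v w vX wX)).
  pose I := [set C : dm_component G | dm_base C \subset X].
  have IP C v : C \in I -> v \in dm_base C -> v \in X.
    by rewrite inE => /subsetP; apply.
  have memI C v : v \in X -> v \in dm_base C -> C \in I.
    by move=> vX vC; rewrite inE; apply/subsetP=> v'; apply: closed vC.
  have legI : legitimate (@dm_smile G) I.
    move=> C1 C2 C1I C2I; apply/negP=> /dm_smile_smiles[Hc /set0Pn[v vC2] sm].
    have [u uC1 _] := consistent_spec Hc.
    by have := Xfree u v (IP _ _ C1I uC1) (IP _ _ C2I vC2); rewrite sm.
  have spanI : spanning (@dm_smile G) I.
    move=> C; rewrite inE => /subsetPn[u uC uX].
    have [v vX vDu] := Xmax u uX (base_notD uC).
    have [C' vC'] := base_ex (XD v vX).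
    by exists C'; [exact: memI vC' | exact: smiles_dm_smile vDu].
  exists I; split=> //.
  - move=> C1 C2 C1I le;
      apply: contraT => /spanI[C3 C3I /existsP[C /andP[le' sm]]].
    case/negP: (legI C1 C3 C1I C3I); apply/existsP; exists C.
    by rewrite sm andbT; apply: connect_trans le le'.
  - apply/subsetP=> C; rewrite inE => Hi; apply: contraT => /spanI[C' _].
    by case/dm_smile_smiles; rewrite Hi.
  apply/setP=> v; apply/idP/bigcupP => [vX|[C CI vC]]; last exact: IP CI vC.
  by have [C vC] := base_ex (XD v vX); exists C => //; apply: memI vC.
have XP v : v \in X -> exists2 C, C \in I & v \in dm_base C.
  by rewrite XE => /bigcupP[C CI vC]; exists C.
split=> [u /XP[C _]|u v /XP[C1 C1I uC1] /XP[C2 C2I vC2]|v vX vD].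
- exact: base_notD.
- apply: contra (legI C1 C2 C1I C2I); exact: smiles_dm_smile.
have [C vC] := base_ex vD.
have CI : C \notin I.
  by apply: contra vX => CI; rewrite XE; apply/bigcupP; exists C.
have [C' C'I /dm_smile_smiles[_ /set0Pn[u uC'] sm]] := spanI C CI.
exists u; last exact: sm.
by rewrite XE; apply/bigcupP; exists C'.
Qed.
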